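(* Let $s,r\ge1$, let $0\le a_1\le\dots\le a_r$ be integers with $\sum_{i=1}^r a_i\le s$, and let $X=\mathbb{P}\left(\mathcal{O}_{\mathbb{P}^s}\oplus\bigoplus_{i=1}^r\mathcal{O}_{\mathbb{P}^s}(a_i)\right)$. Let $t$ be a sufficiently negative real number, let $E:Crit(X;f_t)\to Pic(X)$ be the exceptional map described in the context, let $z_1,z_2\in Crit(X;f_t)$ be two elements and let $D\in Div_T(X)$ be a $T$-invariant divisor. Then $$Hom_D(E(z_1),E(z_2))\neq 0\ \Longrightarrow\ M_D(z_1)=z_2 ,$$ where $M_D:Crit(X;f_t)\to Crit(X;f_t)$ is the monodromy map corresponding to $D$.
   Context: Toric data. $X$ is the smooth toric Fano variety whose fan in $\mathbb{Z}^{s+r}$ has rays $v_0,\dots,v_s,e_0,\dots,e_r$, where $v_1,\dots,v_s,e_1,\dots,e_r$ is the standard basis, $v_0=-\sum_{i=1}^s v_i+\sum_{i=1}^r a_ie_i$, $e_0=-\sum_{i=1}^r e_i$. $V_X(\nu)$ denotes the $T$-invariant prime divisor of the ray $\nu$, and $Div_T(X)$ is the free abelian group on these. $Pic(X)=\mathbb{Z}\,\pi^*H\oplus\mathbb{Z}\,\xi$ with $[V_X(v_i)]=\pi^*H$ and $[V_X(e_j)]=\xi-a_j\pi^*H$ ($a_0=0$). Hom decomposition. For line bundles $L_1,L_2$ on $X$, $Hom(L_1,L_2)=H^0(X;L_2\otimes L_1^{-1})$ has a basis indexed by the effective $T$-invariant divisors $D$ with $[D]=L_2-L_1$ in $Pic(X)$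 (the torus-weight sections with zero divisor $D$); $Hom_D(L_1,L_2)$ is the line spanned by the basis element of $D$ if $D$ is effective with $[D]=L_2-L_1$, and $0$ otherwise. Thus $Hom(L_1,L_2)=\bigoplus_{D\in Div_T(X)}Hom_D(L_1,L_2)$. Landau-Ginzburg data. On $(\mathbb{C}^* )^{s+r}$ with coordinates $(z,w)=(z_1,\dots,z_s,w_1,\dots,w_r)$ let $$f_t(z,w)=1+\sum_{i=1}^s z_i+\sum_{i=1}^r w_i+e^t\frac{w_1^{a_1}\cdots w_r^{a_r}}{z_1\cdots z_s}+\frac{1}{w_1\cdots w_r}.$$ For a Laurent polynomial $f$, $Crit(X;f)$ is the solution set in $(\mathbb{C}^* )^{s+r}$ of $z_i\partial f/\partial z_i=0$, $w_j\partial f/\partial w_j=0$ for all $i,j$. The map $E$. For sufficiently negative $t$, $Crit(X;f_t)$ has exactly $(s+1)(r+1)$ points $(z_{kl},w_{kl})$, $0\le k\le s$, $0\le l\le r$, forming continuous branches in $t$, where the branch $(k,l)$ is characterized by the fact that, as $t\to-\infty$, $Arg$ of each $z$-coordinate tends to $\frac{l\sum_j a_j}{(s+1)(r+1)}+\frac{k}{s+1}$ and $Arg$ of each $w$-coordinate tends to $\frac{l}{r+1}$ in $\mathbb{R}/\mathbb{Z}$ (here $x=|x|e^{2\pi i Arg(x)}$). $E$ is the map $E(z_{kl},w_{kl})=k\,\pi^*H+l\,\xi$. Monodromy. For $D=\sum_{i=0}^s n_iV_X(v_i)+\sum_{i=0}^r m_iV_X(e_i)$ consider the loop of Laurent polynomials,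 $\theta\in[0,1]$, $$\gamma_D^\theta(z,w)=1+\sum_{i=1}^s e^{2\pi i n_i\theta}z_i+\sum_{i=1}^r e^{2\pi i m_i\theta}w_i+e^{t+2\pi i n_0\theta}\frac{w_1^{a_1}\cdots w_r^{a_r}}{z_1\cdots z_s}+\frac{e^{2\pi i m_0\theta}}{w_1\cdots w_r}$$ (in the exponents $i=\sqrt{-1}$ apart from its use as an index), so $\gamma_D^0=\gamma_D^1=f_t$. Following the points of $Crit(X;\gamma_D^\theta)$ continuously from $\theta=0$ to $\theta=1$ (for $t$ sufficiently negative these solution schemes are reduced for all $\theta$) gives the map $M_D:Crit(X;f_t)\to Crit(X;f_t)$. *)

(* Defs.v *)
From HB Require Import structures.
From mathcomp Require Import all_boot all_order all_algebra.
From mathcomp Require Import all_classical all_reals all_analysis.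
From mathcomp Require Import complex.
From mathcomp Require Import ring.

Set Implicit Arguments.
Unset Strict Implicit.
Unset Printing Implicit Defensive.

Import Order.TTheory GRing.Theory Num.Theory numFieldNormedType.Exports.
Local Open Scope classical_set_scope.
Local Open Scope ring_scope.

(* The declared type gives R[i] the topology and the normed-module structure
   that MathComp-Analysis attaches to every numFieldType. *)
Definition Cplx (R : realType) : numClosedFieldType := R[i].

(* [inl i] is the ray v_i (0 <= i <= s), [inr j] is the ray e_j (0 <= j <= r).
   Indices of v_1..v_s and e_1..e_r are [lift ord0 i] with i : 'I_s, resp.
   i : 'I_r; in particular [a i : nat], i : 'I_r, is the integer a_(i+1). *)
Definition ray (s r : nat) : finType := ('I_s.+1 + 'I_r.+1)%type.

Definition lattice (s r : nat) : zmodType := ('rV[int]_s * 'rV[int]_r)%type.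

Definition ray_gen (s r : nat) (a : 'I_r -> nat) (nu : ray s r) :
    lattice s r :=
  match nu with
  | inl i => if unlift ord0 i is Some k then (delta_mx 0 k, 0)
             else (const_mx (-1), \row_j (a j)%:Z)
  | inr j => if unlift ord0 j is Some k then (0, delta_mx 0 k)
             else (0, const_mx (-1))
  end.

Definition pairing (s r : nat) (m u : lattice s r) : int :=
  \sum_i m.1 0 i * u.1 0 i + \sum_j m.2 0 j * u.2 0 j.

Definition DivT (s r : nat) : zmodType := {ffun ray s r -> int}.

Definition prime_div (s r : nat) (nu : ray s r) : DivT s r :=
  [ffun mu => (mu == nu)%:R].

Definition effective (s r : nat) (D : DivT s r) : bool :=
  [forall nu : ray s r, 0 <= D nu].

(* div(chi^m), for a character m in the lattice dual to that of the fan. *)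
Definition div_char (s r : nat) (a : 'I_r -> nat) (m : lattice s r) :
    DivT s r :=
  [ffun nu => pairing m (ray_gen a nu)].

(* (k, l) stands for k pi^*H + l xi. *)
Definition Pic : zmodType := (int * int)%type.
Definition piH : Pic := (1, 0).
Definition xi : Pic := (0, 1).

Definition ray_class (s r : nat) (a : 'I_r -> nat) (nu : ray s r) : Pic :=
  match nu with
  | inl _ => piH
  | inr j => if unlift ord0 j is Some k then xi - piH *~ (a k)%:Z else xi
  end.

Definition div_class (s r : nat) (a : 'I_r -> nat) (D : DivT s r) : Pic :=
  \sum_(nu : ray s r) ray_class a nu *~ D nu.

(* The line bundle L is realised as O_X(L.1 V_X(v_0) + L.2 V_X(e_0)), whose
   sections are Laurent polynomials; [zero_div a L m] is the divisor of the
   character chi^m as a rational section of that line bundle. *)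
Definition bundle_div (s r : nat) (L : Pic) : DivT s r :=
  prime_div (inl ord0) *~ L.1 + prime_div (inr ord0) *~ L.2.

Definition zero_div (s r : nat) (a : 'I_r -> nat) (L : Pic)
    (m : lattice s r) : DivT s r :=
  div_char a m + bundle_div s r L.

Definition chi (R : realType) (s r : nat) (m : lattice s r) :
    lattice s r -> Cplx R :=
  fun m' => (m' == m)%:R.

(* Laurent polynomials are encoded by their coefficients, so H^0(X; L) is the
   span of the chi^m with effective divisor of zeros. *)
Definition H0 (R : realType) (s r : nat) (a : 'I_r -> nat) (L : Pic) :
    set (lattice s r -> Cplx R) :=
  [set phi | finite_set [set m | phi m != 0] /\
             forall m, phi m != 0 -> effective (zero_div a L m)].

Definition HomX (R : realType) (s r : nat) (a : 'I_r -> nat) (L1 L2 : Pic) :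
    set (lattice s r -> Cplx R) :=
  H0 a (L2 - L1).

(* The basis section attached to D is the chi^m with zero divisor D; see
   [zero_div_class] for its existence and uniqueness. *)
Definition HomD (R : realType) (s r : nat) (a : 'I_r -> nat) (D : DivT s r)
    (L1 L2 : Pic) : set (lattice s r -> Cplx R) :=
  if effective D && (div_class a D == L2 - L1) then
    [set phi | exists (c : Cplx R) (m : lattice s r),
       zero_div a (L2 - L1) m = D /\ phi = c *: chi R m]
  else [set 0].
Arguments HomD R {s r} a D L1 L2.

Lemma zero_divE (s r : nat) (a : 'I_r -> nat) (L : Pic) (m : lattice s r) :
  [/\ forall i, zero_div a L m (inl (lift ord0 i)) = m.1 0 i,
      forall j, zero_div a L m (inr (lift ord0 j)) = m.2 0 j,
      zero_div a L m (inl ord0) =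
        - (\sum_i m.1 0 i) + \sum_j (a j)%:Z * m.2 0 j + L.1
    & zero_div a L m (inr ord0) = - (\sum_j m.2 0 j) + L.2].
Proof.
have P n i0 (v : 'rV[int]_n) :
    \sum_i v 0 i * (delta_mx 0 i0 : 'rV[int]_n) 0 i = v 0 i0.
  rewrite (bigD1 i0) //= mxE !eqxx mulr1 big1 ?addr0 // => i /negPf ni.
  by rewrite mxE eqxx ni mulr0.
have Z n (v : 'rV[int]_n) : \sum_i v 0 i * (0 : 'rV[int]_n) 0 i = 0.
  by rewrite big1 // => i _; rewrite mxE mulr0.
have N n (v : 'rV[int]_n) :
    \sum_i v 0 i * (const_mx (-1) : 'rV[int]_n) 0 i = - \sum_i v 0 i.
  by rewrite -sumrN; apply: eq_bigr => i _; rewrite mxE mulrN1.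
have Q (f : DivT s r) n nu : (f *~ n) nu = f nu *~ n.
  by case: n => n; rewrite /intmul ?ffunE ffunMnE.
have B nu : bundle_div s r L nu =
    L.1 *+ (nu == inl ord0) + L.2 *+ (nu == inr ord0).
  rewrite /bundle_div ffunE !Q !ffunE.
  by do 2!case: (_ == _); rewrite ?mul0rz ?intz.
split=> [i|j||]; rewrite ffunE B ffunE /pairing /ray_gen ?liftK ?unlift_none /=.
- by rewrite P Z !addr0.
- by rewrite P Z add0r !addr0.
- rewrite N addr0; congr (_ + _ + _).
  by apply: eq_bigr => j _; rewrite mxE mulrC.
- by rewrite N Z !add0r.
Qed.

Lemma div_classE (s r : nat) (a : 'I_r -> nat) (D : DivT s r) :
  div_class a D =
  (D (inl ord0) + \sum_i D (inl (lift ord0 i))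
     - \sum_j (a j)%:Z * D (inr (lift ord0 j)),
   D (inr ord0) + \sum_j D (inr (lift ord0 j))).
Proof.
have T1 (x y n : int) : (((x, y) : Pic) *~ n) = (n * x, n * y) :> Pic.
  have T2 (k : nat) : (((x, y) : Pic) *+ k) = (x *+ k, y *+ k) :> Pic.
    by elim: k => // k IH; rewrite !mulrS IH.
  rewrite -[n in n * x]intz -[n in n * y]intz !mulrzl.
  by case: n => n; rewrite /intmul T2.
have T3 (I : finType) (F G : I -> int) :
    \sum_i ((F i, G i) : Pic) = (\sum_i F i, \sum_i G i) :> Pic.
  by elim/big_rec3: _ => // i x y z _ ->.
have T4 j : xi - piH *~ (a j)%:Z = (- (a j)%:Z, 1) :> Pic.
  by rewrite T1 mulr1 mulr0; apply/eqP; rewrite xpair_eqE /= sub0r subr0 !eqxx.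
rewrite /div_class big_sumType /= !big_ord_recl /= !unlift_none !T1.
under eq_bigr do rewrite T1.
under [X in _ + (_ + X)]eq_bigr do rewrite liftK T4 T1.
rewrite !T3; congr pair => /=.
  rewrite mulr1 mulr0 [X in _ + X]add0r -sumrN; congr (_ + _ + _).
    by apply: eq_bigr => i _; rewrite mulr1.
  by apply: eq_bigr => j _; rewrite mulrN mulrC.
rewrite mulr0 mulr1 big1 => [|i _]; last by rewrite mulr0.
rewrite !add0r.
by congr (_ + _); apply: eq_bigr => j _; rewrite mulr1.
Qed.

Lemma zero_div_class (s r : nat) (a : 'I_r -> nat) (L : Pic) (D : DivT s r) :
  div_class a D = L <-> exists! m, zero_div a L m = D.
Proof.
split=> [LE|[m [<- _]]]; last first.
  rewrite div_classE.
  have [H1 H2 -> ->] := zero_divE a L m.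
  rewrite (eq_bigr _ (fun i _ => H1 i)) (eq_bigr (m.2 0) (fun j _ => H2 j)).
  under [X in _ - X]eq_bigr do rewrite H2.
  case: L {H1 H2} => k l /=.
  by apply/eqP; rewrite xpair_eqE; apply/andP; split; apply/eqP; ring.
exists (\row_i D (inl (lift ord0 i)), \row_j D (inr (lift ord0 j))); split.
  have [H1 H2 H3 H4] := zero_divE a L
    (\row_i D (inl (lift ord0 i)), \row_j D (inr (lift ord0 j))).
  rewrite /= in H1 H2 H3 H4.
  have S1 : \sum_i (\row_i D (inl (lift ord0 i))) 0 i =
      \sum_i D (inl (lift ord0 i)) by apply: eq_bigr => i _; rewrite mxE.
  have S2 : \sum_i (\row_i D (inr (lift ord0 i))) 0 i =
      \sum_i D (inr (lift ord0 i)) by apply: eq_bigr => i _; rewrite mxE.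
  have S3 : \sum_i (a i)%:Z * (\row_i D (inr (lift ord0 i))) 0 i =
      \sum_i (a i)%:Z * D (inr (lift ord0 i)).
    by apply: eq_bigr => i _; rewrite mxE.
  apply/ffunP => -[i|j].
    case: (unliftP ord0 i) => [k|] ->; first by rewrite H1 mxE.
    by rewrite H3 S1 S3 -LE div_classE /=; ring.
  case: (unliftP ord0 j) => [k|] ->; first by rewrite H2 mxE.
  by rewrite H4 S2 -LE div_classE /=; ring.
move=> [m1 m2] mD; have [H1 H2 _ _] := zero_divE a L (m1, m2).
congr pair; apply/rowP => i; rewrite mxE -mD ?H1 ?H2 //.
Qed.

Lemma HomD_graded (R : realType) (s r : nat) (a : 'I_r -> nat) (D : DivT s r)
    (L1 L2 : Pic) :
  HomD R a D L1 L2 =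
  [set phi | HomX a L1 L2 phi /\
             forall m : lattice s r, phi m != 0 -> zero_div a (L2 - L1) m = D].
Proof.
rewrite /HomD /HomX; set L := L2 - L1.
case: ifPn => [/andP[eD /eqP cD]|nD]; apply/seteqP; split=> phi.
- move=> [c [m [mD ->]]].
  have Z m' : (c *: chi R m) m' != 0 -> m' = m.
    rewrite /GRing.scale /= /chi; case: (eqVneq m' m) => //= _.
    by rewrite scaler0 eqxx.
  split; last by move=> m' /Z ->.
  split; last by move=> m' /Z ->; rewrite mD.
  by apply: (@sub_finite_set _ _ [set m]) => // m' /= /Z.
- move=> [_ h]; have [m [mD mu]] := (zero_div_class a L D).1 cD.
  exists (phi m), m; split=> //; apply/funext => m'.
  rewrite /GRing.scale /= /chi; case: (eqVneq m' m) => [->|nm].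
    by rewrite /= [RHS]mulr1.
  rewrite [RHS]mulr0; apply/eqP; apply: contraNT nm => /h m'D.
  by rewrite (mu _ m'D).
- move=> ->; split; last by move=> m; rewrite eqxx.
  split; last by move=> m; rewrite eqxx.
  by rewrite (_ : mkset _ = set0) //; apply/seteqP; split=> m //=; rewrite eqxx.
- move=> [[_ h1] h2]; apply/funext => m; apply/eqP.
  apply: contraNT nD => phim; have mD := h2 _ phim.
  have := h1 _ phim; rewrite mD => ->; apply/eqP.
  apply: (zero_div_class a L D).2; exists m; split=> // m' m'D.
  have [H1 H2 _ _] := zero_divE a L m; have [H1' H2' _ _] := zero_divE a L m'.
  case: m m' {phim} mD m'D H1 H2 H1' H2' => [m1 m2] [m1' m2'] mD m'D H1 H2 H1' H2'.
  by congr pair; apply/rowP => i; [rewrite -[LHS]H1 -[RHS]H1'|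
    rewrite -[LHS]H2 -[RHS]H2']; rewrite mD m'D.
Qed.

Definition coords (R : realType) (s r : nat) :=
  ('rV[Cplx R]_s * 'rV[Cplx R]_r)%type.

(* e1 x = exp(2 pi i x) *)
Definition e1 (R : realType) (x : R) : Cplx R :=
  Complex (cos (2 * pi * x)) (sin (2 * pi * x)).

Definition Crit (R : realType) (s r : nat)
    (f : 'rV[Cplx R]_s -> 'rV[Cplx R]_r -> Cplx R) : set (coords R s r) :=
  [set p : coords R s r |
    [/\ forall i, p.1 0 i != 0,
        forall j, p.2 0 j != 0,
        forall i, p.1 0 i *
                  'D_(delta_mx 0 i) (fun z => f z p.2) p.1 = 0
      & forall j, p.2 0 j *
                  'D_(delta_mx 0 j) (fun w => f p.1 w) p.2 = 0]].

Definition LG (R : realType) (s r : nat) (a : 'I_r -> nat) (t : R)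
    (z : 'rV[Cplx R]_s) (w : 'rV[Cplx R]_r) : Cplx R :=
  1 + \sum_i z 0 i + \sum_j w 0 j
  + real_complex R (expR t) * ((\prod_j w 0 j ^+ a j) / \prod_i z 0 i)
  + 1 / \prod_j w 0 j.

(* The class of Arg(x) in R/Z, as a coset of Z in R. *)
Definition Arg (R : realType) (x : Cplx R) : set R :=
  [set theta | x = `|x| * e1 theta].

(* Arg (x u) tends to the class of alpha in R/Z as u -> -oo: the neighbourhoods
   of a class in R/Z are the images of the neighbourhoods of a representative.
 *)
Definition Arg_cvg_ninfty (R : realType) (x : R -> Cplx R) (alpha : R) :=
  forall U : set R, nbhs alpha U -> \forall u \near -oo, Arg (x u) `&` U !=set0.

Definition is_branch (R : realType) (s r : nat) (a : 'I_r -> nat) (t : R)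
    (k : 'I_s.+1) (l : 'I_r.+1) (p : R -> coords R s r) : Prop :=
  [/\ {within `]-oo, t], continuous p},
      forall u, u <= t -> Crit (LG a u) (p u),
      forall i, Arg_cvg_ninfty (fun u => (p u).1 0 i)
        (l%:R * (\sum_j a j)%:R / (s.+1%:R * r.+1%:R) + k%:R / s.+1%:R)
    & forall j, Arg_cvg_ninfty (fun u => (p u).2 0 j) (l%:R / r.+1%:R)].

(* E(z) = k pi^*H + l xi if the branch (k, l) passes through z at time t. *)
Definition exc_map (R : realType) (s r : nat) (a : 'I_r -> nat) (t : R)
    (z : coords R s r) : Pic :=
  xget 0 [set L : Pic | exists (k : 'I_s.+1) (l : 'I_r.+1)
                               (p : R -> coords R s r),
            [/\ is_branch a t k l p, p t = z
              & L = piH *~ k%:Z + xi *~ l%:Z]].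

Definition gamma (R : realType) (s r : nat) (a : 'I_r -> nat) (t : R)
    (D : DivT s r) (theta : R) (z : 'rV[Cplx R]_s) (w : 'rV[Cplx R]_r) :
    Cplx R :=
  let n (i : 'I_s.+1) : R := (D (inl i))%:~R in
  let m (j : 'I_r.+1) : R := (D (inr j))%:~R in
  1 + \sum_i e1 (n (lift ord0 i) * theta) * z 0 i
  + \sum_j e1 (m (lift ord0 j) * theta) * w 0 j
  + real_complex R (expR t) * e1 (n ord0 * theta) *
      ((\prod_j w 0 j ^+ a j) / \prod_i z 0 i)
  + e1 (m ord0 * theta) / \prod_j w 0 j.

(* End point of a continuous path of critical points starting at z. *)
Definition monodromy (R : realType) (s r : nat) (a : 'I_r -> nat) (t : R)
    (D : DivT s r) (z : coords R s r) : coords R s r :=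
  xget z [set z' | exists p : R -> coords R s r,
            [/\ {within `[0, 1], continuous p},
                forall theta, theta \in `[0, 1] ->
                  Crit (gamma a t D theta) (p theta),
                p 0 = z
              & p 1 = z']].

(* Main.v *)
(* Let Z and W be the values at a critical point of the monomials of v_0 and e_0.
   The critical equations read e_i z_i = Z and d_j w_j = W - a_j Z, with e_i and
   d_j the unit coefficients of the deformed potential.  So the point is
   determined by x = Z / W and U = 1 / W, which satisfy, with n = r + 1,
   m = s + 1, A = a_1 + ... + a_r and B = m - A >= 1,
     U^n = delta g1(x),   x^m = kappa g2(x) U^B,
   where g1 = prod (1 - a_j x), g2 = prod (1 - a_j x)^a_j, |delta| = 1 and
   |kappa| = e^t.  Eliminating U bounds |x|^(nm) by |kappa|^n |g(x)|, with
   g = g2^n g1^B of degree less than nm, so x is uniformly small for t very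
   negative.  To leading order (x, U) is then a pair (c, lam) with lam^n = delta
   and c^m = kappa lam^B; the corrections x = c Y(c), U = lam V(c) come from the
   unique solution near 1 of V^n = g1(cY), Y^m = g2(cY) V^B, and are continuous
   in c.  Along a path of critical points the label (lam, c), divided by a
   continuous choice of labels, is a root of unity close to a continuous
   function, hence constant.  So branches and monodromy are computed on labels,
   where they are rotations by explicit angles: along the loop of D the
   parameters delta and kappa turn -m and d times if [D] = d pi^*H + m xi, which
   carries the label of (k, l) to that of (k + d, l + m). *)

Require Import Defs.
From HB Require Import structures.
From mathcomp Require Import all_boot all_order all_algebra.
From mathcomp Require Import all_classical all_reals all_analysis.
From mathcomp Require Import complex.
From mathcomp Require Import ring lra.
Set Implicit Arguments.
Unset Strict Implicit.
Unset Printing Implicit Defensive.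
Import Order.TTheory GRing.Theory Num.Theory numFieldNormedType.Exports.
Local Open Scope classical_set_scope.
Local Open Scope ring_scope.

(** * Absolute values, roots and polynomials *)

(** The norm of [R[i]] takes its values in [R[i]]; its real part lives in [R], where [lra] and [nra]
    apply. *)
Definition cabs (R : realType) (x : Cplx R) : R := complex.Re `|x|.

Lemma cabsE (R : realType) (x : Cplx R) : real_complex R (cabs x) = `|x|.
Proof. by rewrite /cabs RRe_real// normr_real. Qed.

Lemma cabs_real (R : realType) (x : R) : cabs (real_complex R x) = `|x|.
Proof. by rewrite /cabs normc_def /= expr0n /= addr0 sqrtr_sqr. Qed.

Lemma cabs_ge0 (R : realType) (x : Cplx R) : 0 <= cabs x.
Proof. by rewrite -ler0c cabsE. Qed.

Lemma cabsM (R : realType) (x y : Cplx R) : cabs (x * y) = cabs x * cabs y.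
Proof.
by apply: (@complexI R); rewrite rmorphM/= !cabsE normrM.
Qed.

Lemma cabsD (R : realType) (x y : Cplx R) : cabs (x + y) <= cabs x + cabs y.
Proof. by rewrite -lecR rmorphD/= !cabsE ler_normD. Qed.

Lemma cabsN (R : realType) (x : Cplx R) : cabs (- x) = cabs x.
Proof. by rewrite /cabs normrN. Qed.

Lemma cabsB (R : realType) (x y : Cplx R) : cabs (x - y) = cabs (y - x).
Proof. by rewrite /cabs distrC. Qed.

Lemma cabs0 (R : realType) : cabs (0 : Cplx R) = 0.
Proof. by rewrite /cabs normr0. Qed.

Lemma cabs1 (R : realType) : cabs (1 : Cplx R) = 1.
Proof. by rewrite /cabs normr1. Qed.

Lemma cabs_eq0 (R : realType) (x : Cplx R) : (cabs x == 0) = (x == 0).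
Proof.
by rewrite -[RHS]normr_eq0 -cabsE -(inj_eq (@complexI R)).
Qed.

Lemma cabs_gt0 (R : realType) (x : Cplx R) : (0 < cabs x) = (x != 0).
Proof. by rewrite lt0r cabs_ge0 andbT cabs_eq0. Qed.

Lemma cabsX (R : realType) (x : Cplx R) n : cabs (x ^+ n) = cabs x ^+ n.
Proof. by elim: n => [|n IH]; rewrite ?expr0 ?cabs1// !exprS cabsM IH. Qed.

Lemma cabsV (R : realType) (x : Cplx R) : cabs x^-1 = (cabs x)^-1.
Proof.
have [->|x0] := eqVneq x 0; first by rewrite invr0 cabs0 invr0.
apply: (mulfI (x := cabs x)); first by rewrite cabs_eq0.
by rewrite -cabsM !mulfV ?cabs1// cabs_eq0.
Qed.

Lemma cabs_nat (R : realType) n : cabs (n%:R : Cplx R) = n%:R.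
Proof.
have -> : (n%:R : Cplx R) = real_complex R n%:R by rewrite rmorph_nat.
by rewrite cabs_real ger0_norm.
Qed.

Lemma cabs_prod (R : realType) (I : Type) (s : seq I) (F : I -> Cplx R) :
  cabs (\prod_(i <- s) F i) = \prod_(i <- s) cabs (F i).
Proof. by elim/big_rec2: _ => [|i y x _ <-]; rewrite ?cabs1// cabsM. Qed.

Lemma cabs_sum (R : realType) (I : Type) (s : seq I) (F : I -> Cplx R) :
  cabs (\sum_(i <- s) F i) <= \sum_(i <- s) cabs (F i).
Proof.
elim/big_rec2: _ => [|i y x _ h]; first by rewrite cabs0.
by rewrite (le_trans (cabsD _ _))// lerD2l.
Qed.

Lemma cabs_dist (R : realType) (x y : Cplx R) :
  cabs x <= cabs y + cabs (x - y).
Proof. by rewrite (le_trans _ (cabsD _ _))// addrC subrK. Qed.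

Lemma cabs_near1 (R : realType) (x : Cplx R) d :
  cabs (1 - x) < d -> 1 - d < cabs x < 1 + d.
Proof.
move=> xd; have := cabs_dist 1 x; have := cabs_dist x 1.
by rewrite cabsB cabs1; lra.
Qed.

Lemma near1_neq0 (R : realType) (x : Cplx R) : cabs (1 - x) < 1 -> x != 0.
Proof. by move=> /cabs_near1 x1; rewrite -cabs_gt0; lra. Qed.

(** * Powers and roots near 1 *)

Lemma mul_near1 (R : realType) (x y : Cplx R) d : d <= 1 ->
  cabs (1 - x) < d / 3 -> cabs (1 - y) < d / 3 -> cabs (1 - x * y) < d.
Proof.
move=> d1 xd yd; have -> : 1 - x * y = (1 - x) + x * (1 - y) by ring.
have := cabsD (1 - x) (x * (1 - y)); rewrite cabsM.
have := cabs_near1 xd; have := cabs_ge0 (1 - y); nra.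
Qed.

Lemma exp_near1 (R : realType) n (e : R) : 0 < e ->
  exists2 d : R, 0 < d & forall x : Cplx R, cabs (1 - x) < d -> cabs (1 - x ^+ n) < e.
Proof.
move=> e0; wlog e1 : e e0 / e <= 1.
  move=> h; have [||d d0 dh] := h (Num.min e 1).
  - by rewrite lt_min e0 ltr01.
  - by rewrite ge_min lexx orbT.
  - by exists d => // x /dh; rewrite lt_min => /andP[].
elim: n e e0 e1 => [|n IH] e e0 e1.
  by exists e => // x _; rewrite expr0 subrr cabs0.
have [||d d0 dh] := IH (e / 3); [lra|lra|].
exists (Num.min d (e / 3)); first by rewrite lt_min d0 /=; lra.
move=> x; rewrite lt_min => /andP[xd xe].
by rewrite exprS; apply: mul_near1 => //; exact: dh.
Qed.

(** The derivative of the n-th power at 1 is n. In the induction, the error for [n.+1] is the error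
    for [n] plus (a - 1)(a^n - b^n) plus (b^n - 1)(a - b), and each piece takes a third of [e]. *)
Lemma sub_exp_near1_approx (R : realType) n (e : R) : 0 < e ->
  exists2 d : R, 0 < d & forall a b : Cplx R, cabs (1 - a) < d -> cabs (1 - b) < d ->
    cabs (a ^+ n - b ^+ n - n%:R * (a - b)) <= e * cabs (a - b).
Proof.
elim: n e => [|n IH] e e0.
  exists 1 => // a b _ _; rewrite !expr0 subrr mul0r subr0 cabs0.
  by rewrite mulr_ge0// ?cabs_ge0// ltW.
have [|d1 d10 h1] := IH (e / 3); first by lra.
have [|d2 d20 h2] := @exp_near1 R n (e / 3); first by lra.
(* Chosen so that d3 (n + e/3) = e/3; the inductive bound gives |a^n - b^n| <= (n + e/3)|a - b|. *)
pose d3 := e / 3 / (n%:R + e / 3).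
have den : 0 < n%:R + e / 3 by rewrite ltr_wpDl//; lra.
have d30 : 0 < d3 by rewrite divr_gt0//; lra.
exists (Num.min d1 (Num.min d2 d3)); first by rewrite !lt_min d10 d20.
move=> a b; rewrite !lt_min => /andP[a1 /andP[a2 a3]] /andP[b1 /andP[b2 b3]].
have := h1 _ _ a1 b1; set u := a ^+ n - b ^+ n - n%:R * (a - b) => hu.
have -> : a ^+ n.+1 - b ^+ n.+1 - n.+1%:R * (a - b) =
    u + ((a - 1) * (u + n%:R * (a - b)) + (b ^+ n - 1) * (a - b)).
  by rewrite /u -natr1 !exprS; ring.
apply: le_trans (cabsD _ _) _.
have -> : e * cabs (a - b) =
    e / 3 * cabs (a - b) + (e / 3 * cabs (a - b) + e / 3 * cabs (a - b)).
  by field.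
apply: lerD; first exact: hu.
apply: le_trans (cabsD _ _) _.
have p1 : cabs ((a - 1) * (u + n%:R * (a - b))) <= e / 3 * cabs (a - b).
  rewrite cabsM; apply: (@le_trans _ _ (d3 * ((n%:R + e / 3) * cabs (a - b)))).
    rewrite ler_pM ?cabs_ge0//; first by rewrite cabsB ltW.
    apply: le_trans (cabsD _ _) _; rewrite cabsM cabs_nat mulrDl addrC.
    by rewrite lerD2l.
  by rewrite mulrA /d3 divfK// gt_eqF.
have p2 : cabs ((b ^+ n - 1) * (a - b)) <= e / 3 * cabs (a - b).
  by rewrite cabsM ler_wpM2r ?cabs_ge0// cabsB ltW// h2.
by rewrite lerD.
Qed.

(** With error 1/2, n|a - b| <= |a^n - b^n| + |a - b|/2, and n >= 1. *)
Lemma sub_exp_near1 (R : realType) n : (0 < n)%N ->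
  exists2 d : R, 0 < d & forall a b : Cplx R,
    cabs (1 - a) < d -> cabs (1 - b) < d ->
    cabs (a - b) <= 2 * cabs (a ^+ n - b ^+ n).
Proof.
move=> n0; have [|d d0 h] := @sub_exp_near1_approx R n (2^-1); first by lra.
exists d => // a b ad bd; have := h _ _ ad bd.
have := cabs_dist (n%:R * (a - b)) (a ^+ n - b ^+ n).
rewrite [cabs (n%:R * _ - _)]cabsB cabsM cabs_nat.
have : 1 <= n%:R :> R by rewrite ler1n.
have := cabs_ge0 (a - b); nra.
Qed.

Lemma exp_near1_inj (R : realType) n : (0 < n)%N ->
  exists2 d : R, 0 < d & forall a b : Cplx R,
    cabs (1 - a) < d -> cabs (1 - b) < d -> a ^+ n = b ^+ n -> a = b.
Proof.
move=> n0; have [d d0 h] := @sub_exp_near1 R n n0.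
exists d => // a b ad bd ab; have := h _ _ ad bd.
rewrite ab subrr cabs0 mulr0 => ab0; apply/eqP; rewrite -subr_eq0 -cabs_eq0.
by rewrite eq_le ab0 cabs_ge0.
Qed.

(* If all roots were at distance at least [e] of [z], the value of [p] at [z],
   which is the product of the differences, could not be small. *)
Lemma monic_root_near (R : realType) (p : {poly Cplx R}) (z : Cplx R) (e : R) :
  p \is monic -> (1 < size p)%N -> 0 <= e -> cabs p.[z] < e ^+ (size p).-1 ->
  exists2 v, root p v & cabs (z - v) < e.
Proof.
move=> pm sp e0 pz; have [s ps] := closed_field_poly_normal p.
rewrite (monicP pm) scale1r in ps.
apply: contrapT => /forall2NP nh; move: pz; apply/negP; rewrite -leNgt.
have sz : (size p).-1 = size s by rewrite ps size_prod_XsubC.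
rewrite sz ps horner_prod cabs_prod.
have {}nh v : v \in s -> e <= cabs (z - v).
  move=> vs; have [|] := nh v; first by rewrite ps root_prod_XsubC vs.
  by move=> /negP; rewrite -leNgt.
elim: s nh {ps sz} => [|v s IH] nh; first by rewrite big_nil expr0.
rewrite big_cons /= exprS ler_pM ?exprn_ge0//.
  by rewrite hornerXsubC nh// mem_head.
by rewrite IH// => w ws; rewrite nh// in_cons ws orbT.
Qed.

(** [monic_root_near] at the point 1 for X^n - q, whose value there is 1 - q. *)
Lemma near1_root (R : realType) n (q : Cplx R) (e : R) : (0 < n)%N -> 0 <= e ->
  cabs (1 - q) < e ^+ n -> exists2 v, v ^+ n = q & cabs (1 - v) < e.
Proof.
move=> n0 e0 qe.
have [||||v] := @monic_root_near R ('X^n - q%:P) 1 e => //.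
- exact: monicXnsubC.
- by rewrite size_XnsubC.
- by rewrite size_XnsubC// !hornerE expr1n.
- rewrite rootE !hornerE subr_eq0 => /eqP; by exists v.
Qed.

Lemma poly_lipschitz (R : realType) (p : {poly Cplx R}) :
  exists2 K : R, 0 <= K & forall x y : Cplx R, cabs x <= 1 -> cabs y <= 1 ->
    cabs (p.[x] - p.[y]) <= K * cabs (x - y).
Proof.
elim/poly_ind: p => [|p c [K K0 hK]].
  by exists 0 => // x y _ _; rewrite !horner0 subrr cabs0 mul0r.
exists (K + (cabs p.[0] + K)); first by rewrite !addr_ge0 ?cabs_ge0.
move=> x y x1 y1; rewrite !hornerMXaddC.
have -> : p.[x] * x + c - (p.[y] * y + c) =
  (p.[x] - p.[y]) * x + p.[y] * (x - y) by ring.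
apply: le_trans (cabsD _ _) _; rewrite (_ : (K + (cabs p.[0] + K)) * _ =
  K * cabs (x - y) + (cabs p.[0] + K) * cabs (x - y)); last by ring.
apply: lerD; rewrite cabsM.
  apply: le_trans (ler_wpM2l (cabs_ge0 _) x1) _; by rewrite mulr1 hK.
apply: ler_wpM2r; first exact: cabs_ge0.
apply: le_trans (cabs_dist _ p.[0]) _; rewrite lerD2l.
apply: le_trans (hK _ _ _ _) _ => //; first by rewrite cabs0.
by rewrite subr0 ler_piMr.
Qed.

Lemma poly_near0 (R : realType) (p : {poly Cplx R}) (e : R) : 0 < e ->
  exists2 d : R, 0 < d & forall x, cabs x < d -> cabs (p.[0] - p.[x]) < e.
Proof.
move=> e0; have [K K0 hK] := poly_lipschitz p.
have K1 : 0 < K + 1 by lra.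
exists (Num.min 1 (e / (K + 1))); first by rewrite lt_min ltr01 divr_gt0.
move=> x; rewrite lt_min => /andP[/ltW x1 xe].
rewrite cabsB; apply: le_lt_trans (hK _ _ x1 _) _; first by rewrite cabs0.
rewrite subr0; move: xe; rewrite ltr_pdivlMr// => xe.
by apply: le_lt_trans xe; rewrite mulrC ler_wpM2l ?cabs_ge0//; lra.
Qed.

Lemma poly_growth (R : realType) (p : {poly Cplx R}) n : (size p <= n)%N ->
  exists2 K : R, 0 <= K & forall x, cabs p.[x] <= K * Num.max 1 (cabs x) ^+ n.-1.
Proof.
move=> pn; exists (\sum_(i < n) cabs p`_i); first by apply: sumr_ge0 => i _; exact: cabs_ge0.
move=> x; rewrite (horner_coef_wide x pn); apply: le_trans (cabs_sum _ _) _.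
rewrite mulr_suml; apply: ler_sum => i _; rewrite cabsM cabsX.
apply: ler_wpM2l; first exact: cabs_ge0.
apply: (@le_trans _ _ (Num.max 1 (cabs x) ^+ i)).
  by rewrite lerXn2r ?nnegrE ?le_max ?cabs_ge0 ?lexx ?orbT.
apply: ler_weXn2l; first by rewrite le_max lexx.
by case: n i {pn} => [[]//|n i]; rewrite -ltnS.
Qed.

(** * Solutions near 1 of the rescaled equations *)

(** Positive elements of [R[i]] are real, so the complex radii in the topology of [Cplx R] can be
    replaced by real ones. *)
Lemma cvg_cabsP (R : realType) (T : Type) (F : set_system T) (FF : Filter F)
    (f : T -> Cplx R) (l : Cplx R) :
  f @ F --> l <-> forall e : R, 0 < e -> \forall x \near F, cabs (l - f x) < e.
Proof.
split=> [/cvgrPdist_lt fl e e0|fl].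
  have ec : 0 < real_complex R e by rewrite (_ : 0 = real_complex R 0)// ltcR.
  by move: (fl _ ec); apply: filterS => x; rewrite -cabsE ltcR.
apply/cvgrPdist_lt => e e0.
have [e' ee] : exists e', e = real_complex R e'.
  by exists (complex.Re e); rewrite RRe_real// gtr0_real.
move: e0; rewrite ee (_ : 0 = real_complex R 0)// ltcR => e0.
by move: (fl _ e0); apply: filterS => x; rewrite -cabsE ltcR.
Qed.

(** What remains of the equations for (x, U) after writing x = c y and U = lam v: the powers of c
    and lam cancel the parameters, and c survives only inside the polynomials. *)
Definition scaled_sol (R : realType) (g1 g2 : {poly Cplx R}) (n m B : nat)
    (c y v : Cplx R) : Prop :=
  v ^+ n = g1.[c * y] /\ y ^+ m = g2.[c * y] * v ^+ B.

Lemma scaled_sol_exp (R : realType) (g1 g2 : {poly Cplx R}) n m B c y v :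
  scaled_sol g1 g2 n m B c y v -> y ^+ (n * m) = (g2 ^+ n * g1 ^+ B).[c * y].
Proof.
move=> [vn ym].
by rewrite mulnC exprM ym exprMn exprAC vn hornerM !horner_exp.
Qed.

(** [sub_exp_near1] bounds |y - y'| by twice the difference of the (n m)-th powers, which by
    [scaled_sol_exp] are values of one polynomial at c y and c' y'. For small c the part of that
    difference due to y - y' is absorbed on the left. Uniqueness (c = c') and continuity in c both
    come from this estimate. *)
Lemma scaled_sol_lipschitz (R : realType) (g1 g2 : {poly Cplx R}) n m B :
  (0 < n)%N -> (0 < m)%N ->
  exists d c0 K : R, [/\ 0 < d, 0 < c0, 0 <= K &
    forall c c' y y' v v', cabs c < c0 -> cabs c' < c0 ->
      cabs (1 - y) < d -> cabs (1 - y') < d ->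
      cabs (1 - v) < d -> cabs (1 - v') < d ->
      scaled_sol g1 g2 n m B c y v -> scaled_sol g1 g2 n m B c' y' v' ->
      cabs (y - y') <= K * cabs (c - c') /\ cabs (v - v') <= K * cabs (c - c')].
Proof.
move=> n0 m0.
have [|d1 d10 h1] := @sub_exp_near1 R (n * m); first by rewrite muln_gt0 n0.
have [d2 d20 h2] := @sub_exp_near1 R n n0.
have [K1 K10 hK1] := poly_lipschitz (g2 ^+ n * g1 ^+ B).
have [K2 K20 hK2] := poly_lipschitz g1.
(* c0 <= 1/2 keeps c y in the unit disc, where the Lipschitz constants hold, and K1 c0 <= 1/8 makes
   the absorbed term at most |y - y'| / 4. *)
pose c0 : R := 2^-1 / (1 + 4 * K1).
have den : 0 < 1 + 4 * K1 by lra.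
have c00 : 0 < c0 by rewrite divr_gt0.
have c0K : c0 * (1 + 4 * K1) = 2^-1 by rewrite /c0 divfK// gt_eqF.
exists (Num.min 1 (Num.min d1 d2)), c0, (8 * K1 + 2 * K2 * (2 + 8 * K1)).
split; rewrite ?lt_min ?ltr01 ?d10//; first by nra.
move=> c c' y y' v v' cc cc'; rewrite !lt_min.
move=> /and3P[y1 yd _] /and3P[y'1 y'd _] /and3P[v1 _ vd] /and3P[v'1 _ v'd] S S'.
have small (u z : Cplx R) : cabs u < c0 -> cabs (1 - z) < 1 -> cabs (u * z) <= 1.
  move=> uc /cabs_near1 z1; rewrite cabsM.
  have := cabs_ge0 u; have := cabs_ge0 z; nra.
have xx : cabs (c * y - c' * y') <= cabs c * cabs (y - y') + 2 * cabs (c - c').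
  have -> : c * y - c' * y' = c * (y - y') + (c - c') * y' by ring.
  apply: le_trans (cabsD _ _) _; rewrite !cabsM lerD2l mulrC.
  by rewrite ler_wpM2r ?cabs_ge0//; have := cabs_near1 y'1; lra.
have yy : cabs (y - y') <= 8 * K1 * cabs (c - c').
  have := h1 _ _ yd y'd.
  rewrite (scaled_sol_exp S) (scaled_sol_exp S') => yE.
  have := hK1 _ _ (small _ _ cc y1) (small _ _ cc' y'1).
  have := cabs_ge0 (y - y'); have := cabs_ge0 (c - c'); have := cabs_ge0 c.
  move: yE xx cc c0K c00.
  set dy := cabs (y - y'); set dc := cabs (c - c'); set G := cabs (_ - _).
  set X := cabs (_ - _).
  move=> yE xx cc c0K c00 ac dc0 dy0 GX.
  have GX2 : G <= K1 * (cabs c * dy + 2 * dc).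
    by apply: le_trans GX _; rewrite ler_wpM2l.
  have Kc : K1 * cabs c <= 8^-1 by nra.
  have : K1 * cabs c * dy <= 8^-1 * dy by rewrite ler_wpM2r.
  have : 0 <= K1 * dc by rewrite mulr_ge0.
  by nra.
split.
  apply: le_trans yy _; rewrite ler_wpM2r ?cabs_ge0//.
  by rewrite lerDl; nra.
have := h2 _ _ vd v'd; rewrite (proj1 S) (proj1 S') => vE.
apply: le_trans vE _.
apply: (@le_trans _ _ (2 * (K2 * (cabs (c * y - c' * y'))))).
  by rewrite ler_wpM2l//; apply: hK2; exact: small.
have xx2 : cabs (c * y - c' * y') <= (2 + 8 * K1) * cabs (c - c').
  apply: le_trans xx _.
  have c1 : cabs c <= 1 by nra.
  have : cabs c * cabs (y - y') <= 1 * cabs (y - y').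
    by rewrite ler_wpM2r ?cabs_ge0.
  by lra.
rewrite mulrA; apply: (@le_trans _ _ (2 * K2 * ((2 + 8 * K1) * cabs (c - c')))).
  by rewrite ler_wpM2l//; lra.
by rewrite mulrA ler_wpM2r ?cabs_ge0// lerDr; lra.
Qed.

(** Eliminating v leaves y^(n m) = g(c y), a monic equation of degree n m that y = 1 nearly
    satisfies. A root y near 1 then determines v as the root near 1 of v^n = g1(c y). *)
Lemma scaled_sol_exists (R : realType) (g1 g2 : {poly Cplx R}) n m B (d : R) :
  (0 < n)%N -> (0 < m)%N -> g1.[0] = 1 -> g2.[0] = 1 ->
  (size (g2 ^+ n * g1 ^+ B)%R <= n * m)%N -> 0 < d ->
  exists2 c0 : R, 0 < c0 & forall c, cabs c < c0 -> exists y v,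
    [/\ cabs (1 - y) < d, cabs (1 - v) < d & scaled_sol g1 g2 n m B c y v].
Proof.
move=> n0 m0 g10 g20 sg d0.
wlog d1 : d d0 / d <= 1.
  move=> h; have [||c0 c00 hc0] := h (Num.min d 1).
  - by rewrite lt_min d0 ltr01.
  - by rewrite ge_min lexx orbT.
  - exists c0 => // c /hc0[y [v [yd vd S]]]; exists y, v.
    by move: yd vd; rewrite !lt_min => /andP[-> _] /andP[-> _].
set g : {poly Cplx R} := g2 ^+ n * g1 ^+ B in sg.
have nm0 : (0 < n * m)%N by rewrite muln_gt0 n0.
have g0 : g.[0] = 1 by rewrite /g hornerM !horner_exp g10 g20 !expr1n mulr1.
have [e e0 he] := @exp_near1_inj R n n0.
pose e1 := Num.min e 1.
have e10 : 0 < e1 by rewrite lt_min e0 ltr01.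
have e11 : e1 <= 1 by rewrite ge_min lexx orbT.
have [|dm dm0 hm] := @exp_near1 R m e1; first by [].
have [|dB dB0 hB] := @exp_near1 R B (e1 / 3); first by lra.
have [|r2 r20 hr2] := @poly_near0 R g2 (e1 / 3); first by lra.
pose d2 := Num.min d (Num.min dm dB).
have d20 : 0 < d2 by rewrite !lt_min d0 dm0.
have [|r1 r10 hr1] := @poly_near0 R g1 (d2 ^+ n); first by rewrite exprn_gt0.
have [|rg rg0 hrg] := @poly_near0 R g (d2 ^+ (n * m)); first by rewrite exprn_gt0.
pose r := Num.min 1 (Num.min rg (Num.min r1 r2)).
have r0 : 0 < r by rewrite !lt_min rg0 r10 r20 ltr01.
exists (r / 2); first by lra.
move=> c cr.
have sgc : (size (g \Po (c *: 'X)) <= n * m)%N.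
  have [->|gn0] := eqVneq g 0; first by rewrite comp_poly0 size_poly0.
  apply: leq_trans (size_comp_poly_leq _ _) _.
  have q2 : ((size (c *: 'X : {poly Cplx R})).-1 <= 1)%N.
    rewrite -subn1 leq_subLR; apply: leq_trans (size_scale_leq _ _) _.
    by rewrite size_polyX.
  apply: leq_trans sg; rewrite -[leqRHS]prednK ?size_poly_gt0// ltnS.
  by rewrite -[leqRHS]muln1 leq_mul2l q2 orbT.
pose P : {poly Cplx R} := 'X^(n * m) - (g \Po (c *: 'X)).
have sP : size P = (n * m).+1.
  by rewrite /P size_polyDl size_polyXn// size_polyN ltnS.
have gcE z : (g \Po (c *: 'X)).[z] = g.[c * z].
  by rewrite horner_comp hornerZ hornerX.
have gc1 : cabs (g.[0] - g.[c]) < d2 ^+ (n * m).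
  by apply: hrg; move: cr r0; rewrite /r !minEle; do 3?case: ifP; lra.
have [||||y] := @monic_root_near R P 1 d2.
- rewrite monicE /P lead_coefDl ?lead_coefXn//.
  by rewrite size_polyN size_polyXn ltnS.
- by rewrite sP ltnS.
- exact: ltW.
- by rewrite sP /P hornerD hornerN hornerXn expr1n gcE mulr1 -g0.
rewrite rootE /P hornerD hornerN hornerXn gcE subr_eq0 => /eqP yE yd.
have cy : cabs (c * y) < r.
  rewrite cabsM; have y2 : cabs y < 2.
    by move: yd; rewrite !lt_min => /andP[/cabs_near1]; lra.
  by have := cabs_ge0 c; have := cabs_ge0 y; nra.
have [cyg [cy1 cy2]] : cabs (c * y) < rg /\ cabs (c * y) < r1 /\ cabs (c * y) < r2.
  by move: cy; rewrite !lt_min => /and4P[_ -> -> ->].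
have [||v vn vd] := @near1_root R n g1.[c * y] d2 n0.
- exact: ltW.
- by rewrite -g10 hr1.
move: (yd) (vd); rewrite !lt_min => /and3P[yd' ym _] /and3P[vd' _ vB].
exists y, v; split => //; split => //.
(* The equation y^m = g2(c y) v^B is known only after raising to the n-th power; both sides are near
   1, where that power is injective. *)
apply: he.
- by have := hm _ ym; rewrite lt_min => /andP[].
- have : cabs (1 - g2.[c * y] * v ^+ B) < e1.
    apply: mul_near1 => //; first by rewrite -g20 hr2.
    exact: hB.
  by rewrite lt_min => /andP[].
- by rewrite -exprM mulnC yE exprMn exprAC vn /g hornerM !horner_exp.
Qed.

Lemma small_solutions (R : realType) (g1 g2 : {poly Cplx R}) n m B (d0 : R) :
  (0 < n)%N -> (0 < m)%N -> g1.[0] = 1 -> g2.[0] = 1 ->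
  (size (g2 ^+ n * g1 ^+ B)%R <= n * m)%N -> 0 < d0 ->
  exists (d c0 : R) (Y V : Cplx R -> Cplx R), [/\ 0 < d <= d0, 0 < c0,
    forall c, cabs c < c0 -> [/\ scaled_sol g1 g2 n m B c (Y c) (V c),
      cabs (1 - Y c) < d & cabs (1 - V c) < d],
    forall c y v, cabs c < c0 -> cabs (1 - y) < d -> cabs (1 - v) < d ->
      scaled_sol g1 g2 n m B c y v -> y = Y c /\ v = V c &
    forall c, cabs c < c0 -> {for c, continuous Y} /\ {for c, continuous V}].
Proof.
move=> n0 m0 g10 g20 sg d00.
have [d1 [c1 [K [d10 c10 K0 hK]]]] := @scaled_sol_lipschitz R g1 g2 n m B n0 m0.
pose d := Num.min d1 d0.
have d_gt0 : 0 < d by rewrite lt_min d10.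
have [c2 c20 hE] := scaled_sol_exists n0 m0 g10 g20 sg d_gt0.
pose c0 := Num.min c1 c2.
(* Outside the disc of radius [c0] the chosen pair is the junk value (0, 0). *)
have /choice[F hF] : forall c, exists yv : Cplx R * Cplx R, cabs c < c0 ->
    [/\ cabs (1 - yv.1) < d, cabs (1 - yv.2) < d & scaled_sol g1 g2 n m B c yv.1 yv.2].
  move=> c; have [|cc] := ltP (cabs c) c0; last by exists (0, 0).
  by rewrite lt_min => /andP[_ /hE[y [v h]]]; exists (y, v).
have lip c c' y y' v v' : cabs c < c0 -> cabs c' < c0 ->
    cabs (1 - y) < d -> cabs (1 - y') < d ->
    cabs (1 - v) < d -> cabs (1 - v') < d ->
    scaled_sol g1 g2 n m B c y v -> scaled_sol g1 g2 n m B c' y' v' ->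
    cabs (y - y') <= K * cabs (c - c') /\ cabs (v - v') <= K * cabs (c - c').
  rewrite !lt_min => /andP[? _] /andP[? _] /andP[? _] /andP[? _] /andP[? _] /andP[? _].
  exact: hK.
exists d, c0, (fun c => (F c).1), (fun c => (F c).2); split.
- by rewrite d_gt0 ge_min lexx orbT.
- by rewrite lt_min c10.
- by move=> c /hF[].
- move=> c y v cc yd vd S; have [Yd Vd SF] := hF _ cc.
  have := lip _ _ _ _ _ _ cc cc yd Yd vd Vd S SF.
  rewrite subrr cabs0 mulr0 => -[+ +].
  by rewrite !le_eqVlt !ltNge !cabs_ge0 !orbF !cabs_eq0 !subr_eq0 => /eqP + /eqP.
- move=> c cc; have [Yd Vd SF] := hF _ cc.
  have cont (f : Cplx R -> Cplx R) : (forall c', cabs c' < c0 ->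
      cabs (f c - f c') <= K * cabs (c - c')) -> {for c, continuous f}.
    move=> hf; apply: (cvg_cabsP (nbhs_filter c) f (f c)).2 => e e0.
    have K1 : 0 < K + 1 by lra.
    have [c_0 c_e] : 0 < c0 - cabs c /\ 0 < e / (K + 1).
      by rewrite subr_gt0 cc divr_gt0.
    near=> c'.
    have ch : cabs (c - c') < c0 - cabs c.
      by near: c'; move: c_0; apply: (cvg_cabsP (nbhs_filter c) id c).1; exact: cvg_id.
    have : cabs (c - c') < e / (K + 1).
      by near: c'; move: c_e; apply: (cvg_cabsP (nbhs_filter c) id c).1; exact: cvg_id.
    rewrite ltr_pdivlMr// => ce; apply: le_lt_trans (hf _ _) _.
      by have := cabs_dist c' c; rewrite cabsB; lra.
    by have := cabs_ge0 (c - c'); nra.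
  split; apply: cont => c' cc'; have [Yd' Vd' SF'] := hF _ cc'.
    by have [] := lip _ _ _ _ _ _ cc cc' Yd Yd' Vd Vd' SF SF'.
  by have [] := lip _ _ _ _ _ _ cc cc' Yd Yd' Vd Vd' SF SF'.
Unshelve. all: by end_near.
Qed.

(** The roots near 1 of v^n = g1(x) and y^m = g2(x) v^B are split off, and the quotients U / v and x
    / y form the label. For this x must be small, which follows from |x|^(n m) = |kap|^n |g(x)| with
    deg g < n m. *)
Lemma labels_exist (R : realType) (g1 g2 : {poly Cplx R}) n m B (d : R) :
  (0 < n)%N -> (0 < m)%N -> g1.[0] = 1 -> g2.[0] = 1 ->
  (size (g2 ^+ n * g1 ^+ B)%R <= n * m)%N -> 0 < d ->
  exists2 k0 : R, 0 < k0 & forall x U kap del : Cplx R, cabs kap < k0 ->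
    cabs del = 1 -> U != 0 -> U ^+ n = del * g1.[x] ->
    x ^+ m = kap * g2.[x] * U ^+ B ->
    exists lam c y v,
      [/\ lam ^+ n = del, c ^+ m = kap * lam ^+ B, U = lam * v & x = c * y] /\
      [/\ cabs (1 - y) < d, cabs (1 - v) < d & scaled_sol g1 g2 n m B c y v].
Proof.
move=> n0 m0 g10 g20 sg d_gt0.
wlog d1 : d d_gt0 / d <= 1.
  move=> h; have [||k0 k00 hk] := h (Num.min d 1).
  - by rewrite lt_min d_gt0 ltr01.
  - by rewrite ge_min lexx orbT.
  - exists k0 => // x U kap del h1 h2 h3 h4 h5.
    have [lam [c [y [v [H1 [yd vd S]]]]]] := hk x U kap del h1 h2 h3 h4 h5.
    exists lam, c, y, v; split => //.
    by move: yd vd; rewrite !lt_min => /andP[-> _] /andP[-> _].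
set g : {poly Cplx R} := g2 ^+ n * g1 ^+ B in sg.
have nm0 : (0 < n * m)%N by rewrite muln_gt0 n0.
have [dB dB0 hB] : exists2 dB : R, 0 < dB & forall x : Cplx R,
    cabs (1 - x) < dB -> cabs (1 - x ^+ B) < d ^+ m / 3.
  by apply: exp_near1; rewrite divr_gt0// exprn_gt0.
have dm1 : d ^+ m <= 1 by rewrite exprn_ile1// ltW.
pose d2 := Num.min d dB.
have d20 : 0 < d2 by rewrite lt_min d_gt0.
have [|r1 r10 hr1] := @poly_near0 R g1 (d2 ^+ n); first by rewrite exprn_gt0.
have [|r2 r20 hr2] := @poly_near0 R g2 (d ^+ m / 3).
  by rewrite divr_gt0// exprn_gt0.
pose r := Num.min 1 (Num.min r1 r2).
have r0 : 0 < r by rewrite !lt_min r10 r20 ltr01.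
have r_le1 : r <= 1 by rewrite ge_min lexx.
have [K K0 hK] := poly_growth sg.
have K1 : 0 < K + 1 by lra.
(* Makes k0 (K + 1) = r^(n m), so that the a priori bound on |x|^(n m) falls below r^(n m); [K + 1]
   is positive even if K = 0. *)
pose k0 := r ^+ (n * m) / (K + 1).
have rnm : 0 < r ^+ (n * m) by rewrite exprn_gt0.
have k00 : 0 < k0 by rewrite divr_gt0.
have k0K : k0 * (K + 1) = r ^+ (n * m) by rewrite divfK// gt_eqF.
exists (Num.min 1 k0); first by rewrite lt_min ltr01.
move=> x U kap del; rewrite lt_min => /andP[kap1 kapk] del1 U0 Un xm.
have rnm1 : r ^+ (n * m) <= 1 by rewrite exprn_ile1// ltW.
have apriori : cabs x ^+ (n * m) = cabs kap ^+ n * cabs g.[x].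
  rewrite -!cabsX -cabsM mulnC exprM xm !exprMn exprAC Un exprMn.
  rewrite /g hornerM !horner_exp !cabsM [cabs (del ^+ B)]cabsX del1 expr1n mul1r.
  by rewrite mulrA.
have kapn : cabs kap ^+ n <= cabs kap.
  by rewrite -(prednK n0) exprS ler_piMr ?cabs_ge0// exprn_ile1 ?cabs_ge0// ltW.
have {}kapn : cabs kap ^+ n * (K + 1) <= cabs kap * (K + 1).
  by apply: ler_wpM2r => //; lra.
have apriori2 : cabs x ^+ (n * m) <= cabs kap * (K + 1) * Num.max 1 (cabs x) ^+ (n * m).-1.
  have M0 : 0 <= Num.max 1 (cabs x) ^+ (n * m).-1.
    by rewrite exprn_ge0// le_max ler01.
  rewrite apriori.
  apply: (@le_trans _ _ (cabs kap ^+ n * (K + 1) * Num.max 1 (cabs x) ^+ (n * m).-1)).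
    rewrite -mulrA; apply: ler_wpM2l; first by rewrite exprn_ge0 ?cabs_ge0.
    apply: le_trans (hK x) _; apply: ler_wpM2r => //; lra.
  exact: ler_wpM2r.
have kapK : cabs kap * (K + 1) < r ^+ (n * m) by rewrite -k0K ltr_pM2r.
(* If |x| >= 1, dividing the bound by |x|^(n m - 1) would give |x| <= |kap| (K + 1) < 1. *)
have x1 : cabs x < 1.
  rewrite ltNge; apply/negP => x1; move: apriori2.
  rewrite max_r// -{1}[(n * m)%N]prednK// exprS.
  rewrite ler_pM2r ?exprn_gt0//; last by lra.
  by lra.
have xr : cabs x < r.
  move: apriori2; rewrite max_l ?(ltW x1)// expr1n mulr1 => xk.
  by rewrite -(@ltr_pXn2r _ (n * m)%N) ?nnegrE ?cabs_ge0 ?(ltW r0)//; lra.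
move: (xr); rewrite !lt_min => /and3P[_ xr1 xr2].
have [||v vn vd] := @near1_root R n g1.[x] d2 n0.
- exact: ltW.
- by rewrite -g10 hr1.
have [vd1 vdB] : cabs (1 - v) < d /\ cabs (1 - v) < dB.
  by move: vd; rewrite lt_min => /andP[].
have [||y ym yd] := @near1_root R m (g2.[x] * v ^+ B) d m0.
- exact: ltW.
- by apply: mul_near1 => //; [rewrite -g20 hr2|exact: hB].
have v0 : v != 0 by apply: near1_neq0; lra.
have y0 : y != 0 by apply: near1_neq0; lra.
exists (U / v), (x / y), y, v; split; split; rewrite ?divfK//.
- by rewrite exprMn exprVn Un vn mulfK// -vn expf_neq0.
- rewrite !exprMn !exprVn xm ym.
  have : g2.[x] != 0.
    by have : y ^+ m != 0 by [rewrite expf_neq0]; rewrite ym mulf_eq0 negb_or => /andP[].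
  move=> g2x; have vB : v ^+ B != 0 by rewrite expf_neq0.
  by field; rewrite ?g2x ?vB ?v0.
- by split; rewrite divfK.
Qed.

(** * Roots of unity along paths *)

Lemma e1D (R : realType) (x y : R) : e1 (x + y) = e1 x * e1 y.
Proof.
rewrite /e1 mulrDr cosD sinD; apply/eqP; rewrite eq_complex /= eqxx /=.
by rewrite addrC.
Qed.

Lemma e1_0 (R : realType) : e1 (0 : R) = 1.
Proof. by rewrite /e1 mulr0 cos0 sin0. Qed.

Lemma e1_1 (R : realType) : e1 (1 : R) = 1.
Proof. by rewrite /e1 mulr1 mulr_natl cos2pi sin2pi. Qed.

Lemma e1_neq0 (R : realType) (x : R) : e1 x != 0.
Proof.
have : e1 x * e1 (- x) != 0 by rewrite -e1D subrr e1_0 oner_neq0.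
by apply: contraNneq => ->; rewrite mul0r.
Qed.

Lemma e1N (R : realType) (x : R) : e1 (- x) = (e1 x)^-1.
Proof.
by apply: (mulfI (e1_neq0 x)); rewrite -e1D subrr e1_0 mulfV ?e1_neq0.
Qed.

Lemma e1Mn (R : realType) (n : nat) (x : R) : e1 (n%:R * x) = e1 x ^+ n.
Proof.
elim: n => [|n IH]; first by rewrite mul0r e1_0.
by rewrite -natr1 mulrDl mul1r e1D IH exprSr.
Qed.

Lemma e1Mz (R : realType) (n : int) (x : R) : e1 (n%:~R * x) = e1 x ^ n.
Proof.
by case: n => n; rewrite ?NegzE ?mulrNz ?mulNr ?e1N -?pmulrn e1Mn.
Qed.

Lemma e1_int (R : realType) (n : int) : e1 (n%:~R : R) = 1.
Proof. by rewrite -[_%:~R]mulr1 e1Mz e1_1 exp1rz. Qed.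

Lemma e1_sum (R : realType) (I : Type) (s : seq I) (F : I -> R) :
  e1 (\sum_(i <- s) F i) = \prod_(i <- s) e1 (F i).
Proof. by elim/big_rec2: _ => [|i y x _ <-]; rewrite ?e1_0// e1D. Qed.

Lemma cabs_e1 (R : realType) (x : R) : cabs (e1 x) = 1.
Proof. by rewrite /cabs normc_def /= cos2Dsin2 sqrtr1. Qed.

Lemma cabs_e1M (R : realType) (rho x : R) : 0 <= rho ->
  cabs (real_complex R rho * e1 x) = rho.
Proof. by move=> r0; rewrite cabsM cabs_e1 mulr1 cabs_real ger0_norm. Qed.

Lemma continuous_real_complex (R : realType) :
  continuous (real_complex R : R -> Cplx R).
Proof.
move=> x; apply: (cvg_cabsP (nbhs_filter x) (real_complex R) _).2 => e e0.
near=> y; rewrite -rmorphB/= cabs_real; near: y.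
by move: e0; apply: (cvgrPdist_lt id x).1; exact: cvg_id.
Unshelve. all: by end_near.
Qed.

Lemma continuous_e1 (R : realType) : continuous (@e1 R).
Proof.
have -> : @e1 R = fun x => (real_complex R (cos (2 * pi * x)) : Cplx R) +
    (Complex 0 1 : Cplx R) * (real_complex R (sin (2 * pi * x)) : Cplx R).
  by apply/funext => x; rewrite [LHS]complexE.
move=> x; have l2 : (2 * pi * y) @[y --> x] --> (2 * pi * x).
  by apply: cvgMr; exact: cvg_id.
apply: cvgD; last apply: cvgMr.
  apply: (@cvg_comp _ _ _ (fun y => cos (2 * pi * y)) (real_complex R : R -> Cplx R)).
    by apply: (@cvg_comp _ _ _ _ (@cos R)); [exact: l2|exact: continuous_cos].
  exact: continuous_real_complex.
apply: (@cvg_comp _ _ _ (fun y => sin (2 * pi * y)) (real_complex R : R -> Cplx R)).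
  by apply: (@cvg_comp _ _ _ _ (@sin R)); [exact: l2|exact: continuous_sin].
exact: continuous_real_complex.
Qed.

(** cos(2 pi x) = 1 - 2 sin(pi x)^2 is below 1, since sin is positive on ]0, pi[. *)
Lemma e1_neq1 (R : realType) (x : R) : 0 < x < 1 -> e1 x != 1.
Proof.
move=> /andP[x0 x1]; apply/negP => /eqP/(congr1 (@complex.Re R)) /=.
have pi0 := pi_gt0 R.
have s0 : 0 < sin (pi * x).
  by apply: sin_gt0_pi; rewrite mulr_gt0//= -[ltRHS]mulr1 ltr_pM2l.
rewrite -mulrA mulr_natl cos_mulr2n.
have := cos2Dsin2 (pi * x).
have : 0 < sin (pi * x) ^+ 2 by rewrite exprn_gt0.
by set c2 := cos _ ^+ 2; set s2 := sin _ ^+ 2; rewrite mulr2n; lra.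
Qed.

Lemma e1_prim_root (R : realType) n : (0 < n)%N ->
  n.-primitive_root (e1 (n%:R^-1 : R)).
Proof.
move=> n0; rewrite /primitive_root_of_unity n0 /=; apply/forallP => i.
have nR : 0 < n%:R :> R by rewrite ltr0n.
apply/eqP; rewrite unity_rootE -e1Mn.
have [->|ni] := eqVneq i.+1 n; first by rewrite divff ?(gt_eqF nR)// e1_1 eqxx.
apply/negbTE/e1_neq1; rewrite divr_gt0//= ltr_pdivrMr// mul1r ltr_nat.
by rewrite ltn_neqAle ni ltn_ord.
Qed.

Lemma unity_root_e1 (R : realType) n (z : Cplx R) : (0 < n)%N ->
  z ^+ n = 1 -> exists k : 'I_n, z = e1 (k%:R / n%:R).
Proof.
by move=> n0 /(prim_rootP (e1_prim_root R n0))[k ->]; exists k; rewrite e1Mn.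
Qed.

Lemma continuous_cabsB (R : realType) (a : Cplx R) :
  continuous (fun z : Cplx R => cabs (a - z)).
Proof.
move=> z; apply: (@cvgrPdist_lt _ _ _ _ (nbhs_filter z) (fun u => cabs (a - u)) (cabs (a - z))).2.
move=> e e0; near=> y.
have : cabs (z - y) < e.
  near: y; move: e0; apply: (cvg_cabsP (nbhs_filter z) id z).1.
  exact: cvg_id.
apply: le_lt_trans; rewrite ler_norml.
have := cabs_dist (a - z) (a - y); have := cabs_dist (a - y) (a - z).
rewrite (_ : a - y - (a - z) = z - y); last by ring.
rewrite (_ : a - z - (a - y) = - (z - y)) ?cabsN; last by ring.
lra.
Unshelve. all: by end_near.
Qed.

(** The n-th roots of unity are isolated, so a continuous function that stays close to them cannot
    pass from one to another on an interval. This makes labels, determined pointwise up to roots of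
    unity, rigid along paths. *)
Lemma near_unity_path (R : realType) n : (0 < n)%N ->
  exists2 e0 : R, 0 < e0 & forall (I : set R) (f : R -> Cplx R) t0,
    is_interval I -> {within I, continuous f} ->
    (forall t, I t -> exists2 om, om ^+ n = 1 & cabs (om - f t) < e0) ->
    I t0 -> cabs (1 - f t0) < e0 ->
    forall t om, I t -> om ^+ n = 1 -> cabs (om - f t) < e0 -> om = 1.
Proof.
move=> n0; have [d d0 hd] := @exp_near1_inj R n n0.
(* Half of a radius within which 1 is the only n-th root of unity, to leave room for the triangle
   inequality. *)
exists (d / 2); first by lra.
move=> I f t0 itvI fI hom It0 ft0.
have om_eq1 t om : cabs (1 - f t) <= d / 2 -> om ^+ n = 1 ->
    cabs (om - f t) < d / 2 -> om = 1.
  move=> ft om1 omf; apply: hd; rewrite ?expr1n ?subrr ?cabs0//.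
  have := cabs_dist (1 - om) (1 - f t).
  rewrite (_ : 1 - om - (1 - f t) = - (om - f t)) ?cabsN; last by ring.
  lra.
have dec t : I t -> cabs (1 - f t) <= d / 2 -> cabs (1 - f t) < d / 2.
  by move=> /hom[om om1 omf] ft; rewrite -{1}(om_eq1 t om).
pose g : R -> R := fun t => cabs (1 - f t).
have gI : {within I, continuous g}.
  move=> x; exact: (@continuous_comp (subspace I) (Cplx R) R f
    (fun z => cabs (1 - z)) x (fI x) (@continuous_cabsB R 1 (f x))).
(* [om_eq1] makes the strict and the large inequality equivalent, so [J] is
   both open and closed in [I]. *)
pose J := I `&` [set t | cabs (1 - f t) < d / 2].
suff JI : J = I.
  move=> t om It; have [_ /ltW ft] : J t by rewrite JI.
  exact: om_eq1.
apply: (connected_intervalP I).2 => //.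
- by exists t0.
- have : open (g @^-1` [set x | x < d / 2] : set (subspace I)).
    by move/continuousP : gI; apply; exact: open_lt.
  move=> /open_subspaceP[C oC CI]; exists C => //.
  by rewrite setIC CI setIC.
- have : closed (g @^-1` [set x | x <= d / 2] : set (subspace I)).
    by move/continuous_closedP : gI; apply; exact: closed_le.
  move=> /closed_subspaceP[C oC CI]; exists C => //.
  rewrite setIC CI setIC; apply/seteqP; split=> t [It ft]; split => //.
    exact: ltW.
  exact: dec.
Qed.

(** * Critical points *)

Lemma derive_line (K : numFieldType) (V W : normedModType K) (f : V -> W)
    (p v : V) : 'D_v f p = 'D_1 (fun h : K => f (h *: v + p)) 0.
Proof.
rewrite /derive; set phi := (fun h : K => f (h *: v + p)).
suff -> : (fun h : K => h^-1 *: ((f \o shift p) (h *: v) - f p)) =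
    (fun h : K => h^-1 *: ((phi \o shift 0) (h *: 1) - phi 0)) by [].
apply/funext => h; rewrite /phi /=.
by rewrite addr0 scale0r add0r [h%:A]mulr1.
Qed.

(** The shape of the potentials along a coordinate line. In the direction of w_j the monomial of v_0
    has exponent [a j] and that of e_0 exponent -1; in the direction of z_i the monomial of v_0 has
    exponent -1 and [k] is 0. *)
Lemma derive_laurent (K : numFieldType) (c b k q x : K) n : x != 0 ->
  'D_1 (fun h : K => c + b * h + k * (h + x) ^+ n + q / (h + x)) 0 =
  b + k * (n%:R * x ^+ n.-1) - q * x ^- 2.
Proof.
move=> x0; pose f : K -> K := fun h => h + x.
have df : is_derive (0 : K) 1 f (1 + 0).
  exact: (@is_deriveD K K K id (cst x) 0 1 1 0).
have f0 : f 0 = x by rewrite /f add0r.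
have dV : is_derive (0 : K) 1 (fun y => (f y)^-1) (- x ^- 2 *: (1 + 0)).
  split; first by apply: derivableV; rewrite ?f0.
  by rewrite deriveV ?f0// (@derive_val _ _ _ _ _ _ _ df).
have dn := @is_deriveX _ _ f n _ _ _ df.
have -> : (fun h : K => c + b * h + k * (h + x) ^+ n + q / (h + x)) =
    (cst c + b \*: (id : K -> K)) + k \*: (f ^+ n) + q \*: (fun y => (f y)^-1).
  apply/funext => h.
  rewrite -[RHS]/(c + b * h + k * ((f ^+ n) h) + q * (f h)^-1).
  by congr (_ + _ * _ + _); rewrite /f exprfctE.
have dl : is_derive (0 : K) 1 (b \*: (id : K -> K)) (b *: 1).
  exact: (@is_deriveZ K K K id b 0 1 1).
have D := is_deriveD (is_deriveD (is_deriveD (@is_derive_cst K K K c 0 1) dl)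
  (is_deriveZ k dn)) (is_deriveZ q dV).
rewrite (@derive_val _ _ _ _ _ _ _ D) f0 /GRing.scale /=.
by rewrite /GRing.scale /=; ring.
Qed.

Lemma row_shift (K : fieldType) n (p : 'rV[K]_n) (i j : 'I_n) (h : K) :
  (h *: delta_mx 0 i + p) 0 j = (if j == i then h + p 0 i else p 0 j).
Proof.
rewrite !mxE eqxx /=; case: eqVneq => [->|_]; first by rewrite mulr1.
by rewrite mulr0 add0r.
Qed.

Lemma prod_shift (K : fieldType) n (p : 'rV[K]_n) (i : 'I_n) (h : K) (b : 'I_n -> nat) :
  \prod_j (h *: delta_mx 0 i + p) 0 j ^+ b j =
  (h + p 0 i) ^+ b i * \prod_(j | j != i) p 0 j ^+ b j.
Proof.
rewrite (bigD1 i) //= row_shift eqxx; congr (_ * _).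
by apply: eq_bigr => j /negPf ji; rewrite row_shift ji.
Qed.

Lemma prod_shift1 (K : fieldType) n (p : 'rV[K]_n) (i : 'I_n) (h : K) :
  \prod_j (h *: delta_mx 0 i + p) 0 j =
  (h + p 0 i) * \prod_(j | j != i) p 0 j.
Proof.
rewrite (bigD1 i) //= row_shift eqxx; congr (_ * _).
by apply: eq_bigr => j /negPf ji; rewrite row_shift ji.
Qed.

Lemma sum_shift (K : fieldType) n (p : 'rV[K]_n) (i : 'I_n) (h : K) (b : 'I_n -> K) :
  \sum_j b j * (h *: delta_mx 0 i + p) 0 j =
  b i * h + \sum_j b j * p 0 j.
Proof.
rewrite (bigD1 i) //= [in RHS](bigD1 i) //= row_shift eqxx mulrDr -!addrA.
congr (_ + (_ + _)).
by apply: eq_bigr => j /negPf ji; rewrite row_shift ji.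
Qed.

(** A logarithmic derivative multiplies each monomial by its exponent. [P] and [Q] are the terms of
    v_0 and e_0: z_i has exponent -1 in [P], and w_j has exponents [a j] in [P] and -1 in [Q]. *)
Lemma Crit_gamma (R : realType) (s r : nat) (a : 'I_r -> nat) (t : R)
    (D : DivT s r) (th : R) (z : 'rV[Cplx R]_s) (w : 'rV[Cplx R]_r) :
  let n i : R := (D (inl i))%:~R in
  let m j : R := (D (inr j))%:~R in
  let P := real_complex R (expR t) * e1 (n ord0 * th) *
             ((\prod_j w 0 j ^+ a j) / \prod_i z 0 i) in
  let Q := e1 (m ord0 * th) / \prod_j w 0 j in
  Crit (gamma a t D th) (z, w) <->
  [/\ forall i, z 0 i != 0, forall j, w 0 j != 0,
      forall i, e1 (n (lift ord0 i) * th) * z 0 i = P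
    & forall j, e1 (m (lift ord0 j) * th) * w 0 j + (a j)%:R * P = Q].
Proof.
move=> n m P Q.
have Dz i : z 0 i != 0 ->
    z 0 i * 'D_(delta_mx 0 i) (fun z => gamma a t D th z w) z =
    e1 (n (lift ord0 i) * th) * z 0 i - P.
  move=> zi0; rewrite derive_line.
  pose q := real_complex R (expR t) * e1 (n ord0 * th) * (\prod_j w 0 j ^+ a j)
    / \prod_(j | j != i) z 0 j.
  pose c := 1 + \sum_i e1 (n (lift ord0 i) * th) * z 0 i
    + \sum_j e1 (m (lift ord0 j) * th) * w 0 j + Q.
  have -> : (fun h : Cplx R => gamma a t D th (h *: delta_mx 0 i + z) w) =
     (fun h => c + e1 (n (lift ord0 i) * th) * h + 0 * (h + z 0 i) ^+ 0 + q / (h + z 0 i)).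
    apply/funext => h; rewrite /gamma sum_shift.
    by rewrite prod_shift1 /c /q /Q invfM; ring.
  have zE : \prod_i z 0 i = z 0 i * \prod_(j | j != i) z 0 j by rewrite (bigD1 i).
  rewrite derive_laurent // /P /q zE !invfM.
  rewrite mul0r addr0 mulrBr; congr (_ - _); first by rewrite mulrC.
  by set Y := (\prod_(j | j != i) _)^-1; field.
have Dw j : w 0 j != 0 ->
    w 0 j * 'D_(delta_mx 0 j) (fun w => gamma a t D th z w) w =
    e1 (m (lift ord0 j) * th) * w 0 j + (a j)%:R * P - Q.
  move=> wj0; rewrite derive_line.
  pose k := real_complex R (expR t) * e1 (n ord0 * th) *
    ((\prod_(l | l != j) w 0 l ^+ a l) / \prod_i z 0 i).
  pose q := e1 (m ord0 * th) / \prod_(l | l != j) w 0 l.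
  pose c := 1 + \sum_i e1 (n (lift ord0 i) * th) * z 0 i
    + \sum_j e1 (m (lift ord0 j) * th) * w 0 j.
  have -> : (fun h : Cplx R => gamma a t D th z (h *: delta_mx 0 j + w)) =
     (fun h => c + e1 (m (lift ord0 j) * th) * h + k * (h + w 0 j) ^+ a j + q / (h + w 0 j)).
    apply/funext => h; rewrite /gamma sum_shift prod_shift.
    by rewrite prod_shift1 /c /q /k invfM; ring.
  have wE : \prod_l w 0 l = w 0 j * \prod_(l | l != j) w 0 l by rewrite (bigD1 j).
  have waE : \prod_l w 0 l ^+ a l = w 0 j ^+ a j * \prod_(l | l != j) w 0 l ^+ a l.
    by rewrite (bigD1 j).
  rewrite derive_laurent // /P /Q /q /k wE waE !invfM.
  (* For [a j = 0] the truncated predecessor gives exponent 0, but the factor [a j] kills the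
     term. *)
  have aw : w 0 j * ((a j)%:R * w 0 j ^+ (a j).-1) = (a j)%:R * w 0 j ^+ a j.
    by case: (a j) => [|l]; rewrite ?mul0r ?mulr0//= exprS; ring.
  rewrite mulrBr mulrDr; congr (_ + _ - _); first by rewrite mulrC.
    by rewrite mulrCA aw; ring.
  by set Y := (\prod_(l | l != j) w 0 l)^-1; field.
split=> [[/= z0 w0 Hz Hw]|[z0 w0 Hz Hw]]; split=> //=.
- by move=> i; apply/eqP; rewrite -subr_eq0 -Dz// Hz.
- by move=> j; apply/eqP; rewrite -subr_eq0 -Dw// Hw.
- by move=> i; rewrite Dz// Hz subrr.
- by move=> j; rewrite Dw// Hw subrr.
Qed.

(** * Reduction of the critical equations to two unknowns *)

(** With b = 1 this is the polynomial g1, with b = a it is g2. *)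
Definition weight_poly (R : realType) (r : nat) (a b : 'I_r -> nat) :
    {poly Cplx R} :=
  \prod_j (1 - (a j)%:R *: 'X) ^+ b j.

Lemma horner_weight_poly (R : realType) (r : nat) (a b : 'I_r -> nat) (x : Cplx R) :
  (weight_poly R a b).[x] = \prod_j (1 - (a j)%:R * x) ^+ b j.
Proof.
rewrite /weight_poly horner_prod; apply: eq_bigr => j _.
by rewrite horner_exp hornerD hornerN hornerZ hornerX hornerC.
Qed.

Lemma weight_poly0 (R : realType) (r : nat) (a b : 'I_r -> nat) :
  (weight_poly R a b).[0] = 1.
Proof.
by rewrite horner_weight_poly big1// => j _; rewrite mulr0 subr0 expr1n.
Qed.

Lemma size_mul_le (K : fieldType) (p q : {poly K}) k l :
  (size p <= k.+1)%N -> (size q <= l.+1)%N -> (size (p * q)%R <= (k + l).+1)%N.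
Proof.
move=> pk ql; apply: leq_trans (size_polyMleq _ _) _.
by rewrite -subn1 leq_subLR add1n -addSn -addnS leq_add.
Qed.

Lemma size_exp_le (K : fieldType) (p : {poly K}) k n :
  (size p <= k.+1)%N -> (size (p ^+ n)%R <= (n * k).+1)%N.
Proof.
move=> pk; elim: n => [|n IH]; first by rewrite expr0 size_poly1.
by rewrite exprS mulSn; exact: size_mul_le.
Qed.

Lemma size_weight_poly (R : realType) (r : nat) (a b : 'I_r -> nat) :
  (size (weight_poly R a b) <= (\sum_j b j).+1)%N.
Proof.
rewrite /weight_poly; elim/big_rec2: _ => [|j k p _ pk]; first by rewrite size_poly1.
apply: size_mul_le pk.
have q2 : (size (1 - (a j)%:R *: 'X : {poly Cplx R})%R <= 2)%N.
  apply: leq_trans (size_polyD _ _) _; rewrite size_poly1 geq_max /= size_polyN.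
  by apply: leq_trans (size_scale_leq _ _) _; rewrite size_polyX.
by have := size_exp_le (b j) q2; rewrite muln1.
Qed.

(** With n = r + 1, m = s + 1 and B = m - A, the degree is at most n A + r B = n m - B; A <= s gives
    B >= 1. *)
Lemma size_weight_polyM (R : realType) (s r : nat) (a : 'I_r -> nat) :
  (\sum_j a j <= s)%N ->
  (size (weight_poly R a a ^+ r.+1 *
         weight_poly R a (fun=> 1%N) ^+ (s.+1 - \sum_j a j))%R <= r.+1 * s.+1)%N.
Proof.
move=> As; apply: leq_trans (size_mul_le (size_exp_le _ (size_weight_poly R a a))
  (size_exp_le _ (size_weight_poly R a _))) _.
rewrite sum_nat_const card_ord muln1; have : (0 < s.+1 - \sum_j a j)%N by rewrite subn_gt0.
set A := (\sum_j a j)%N; set B := (s.+1 - A)%N => B0.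
have sE : s.+1 = (A + B)%N by rewrite subnKC// ltnW.
by rewrite sE mulnDr -addnS leq_add2l mulSn mulnC -add1n leq_add2r.
Qed.

(** Solves e_i z_i = Z and d_j w_j = W - a_j Z for the coordinates, with Z = x / U and W = 1 / U. *)
Definition crit_pt (R : realType) (s r : nat) (a : 'I_r -> nat) (D : DivT s r)
    (th : R) (x U : Cplx R) : coords R s r :=
  (\row_i (x / U / e1 ((D (inl (lift ord0 i)))%:~R * th)),
   \row_j ((1 - (a j)%:R * x) / U / e1 ((D (inr (lift ord0 j)))%:~R * th))).

(* [x] and [U] stand for Z / W and 1 / W, where Z and W are the values at the
   critical point of the monomials of the rays v_0 and e_0. *)
Definition reduced_eq (R : realType) (s r : nat) (a : 'I_r -> nat) (t : R)
    (d : Pic) (th : R) (x U : Cplx R) : Prop :=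
  [/\ x != 0, U != 0,
      U ^+ r.+1 = e1 (- (d.2%:~R * th)) * (weight_poly R a (fun=> 1%N)).[x]
    & x ^+ s.+1 = real_complex R (expR t) * e1 (d.1%:~R * th) *
        (weight_poly R a a).[x] * U ^+ (s.+1 - \sum_j a j)].

Lemma prod_crit_pt (R : realType) (s r : nat) (a : 'I_r -> nat) (D : DivT s r)
    (th : R) (x U : Cplx R) (b : 'I_r -> nat) :
  \prod_j (crit_pt a D th x U).2 0 j ^+ b j =
  (weight_poly R a b).[x] / (U ^+ (\sum_j b j) *
    \prod_j e1 ((D (inr (lift ord0 j)))%:~R * th) ^+ b j).
Proof.
rewrite horner_weight_poly -prodrXr -big_split -prodfV -big_split /=.
apply: eq_bigr => j _; rewrite mxE !exprMn !exprVn invfM.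
by rewrite mulrA.
Qed.

Lemma prod_crit_pt1 (R : realType) (s r : nat) (a : 'I_r -> nat) (D : DivT s r)
    (th : R) (x U : Cplx R) :
  \prod_i (crit_pt a D th x U).1 0 i =
  x ^+ s / (U ^+ s * \prod_i e1 ((D (inl (lift ord0 i)))%:~R * th)).
Proof.
transitivity (\prod_(i < s) (x * (U * e1 ((D (inl (lift ord0 i)))%:~R * th))^-1)).
  by apply: eq_bigr => i _; rewrite mxE invfM mulrA.
rewrite big_split /= prodfV big_split /= !prodr_const card_ord //.
Qed.

Lemma prod_crit_pt2 (R : realType) (s r : nat) (a : 'I_r -> nat) (D : DivT s r)
    (th : R) (x U : Cplx R) :
  \prod_j (crit_pt a D th x U).2 0 j =
  (weight_poly R a (fun=> 1%N)).[x] /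
    (U ^+ r * \prod_j e1 ((D (inr (lift ord0 j)))%:~R * th)).
Proof.
have expr1_prod (F : 'I_r -> Cplx R) : \prod_j F j = \prod_j F j ^+ 1.
  by apply: eq_bigr => j _; rewrite expr1.
rewrite expr1_prod (prod_crit_pt a D th x U (fun=> 1%N)) -expr1_prod.
by rewrite sum_nat_const card_ord muln1.
Qed.

(** In the reduced equations the unit coefficients of the loop occur only in this combination and in
    that of [e1_class2], so these equations see [D] only through its class. *)
Lemma e1_class1 (R : realType) (s r : nat) (a : 'I_r -> nat) (D : DivT s r) (th : R) :
  e1 ((div_class a D).1%:~R * th) = e1 ((D (inl ord0))%:~R * th) *
    \prod_i e1 ((D (inl (lift ord0 i)))%:~R * th) /
    \prod_j e1 ((D (inr (lift ord0 j)))%:~R * th) ^+ a j.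
Proof.
rewrite div_classE /= rmorphB rmorphD /= !rmorph_sum /= mulrBl mulrDl !mulr_suml.
rewrite !e1D e1N !e1_sum; congr (_ * _ / _); apply: eq_bigr => j _.
by rewrite rmorphM /= -mulrA -e1Mn.
Qed.

Lemma e1_class2 (R : realType) (s r : nat) (a : 'I_r -> nat) (D : DivT s r) (th : R) :
  e1 ((div_class a D).2%:~R * th) = e1 ((D (inr ord0))%:~R * th) *
    \prod_j e1 ((D (inr (lift ord0 j)))%:~R * th).
Proof.
by rewrite div_classE /= rmorphD /= !rmorph_sum /= mulrDl !mulr_suml e1D e1_sum.
Qed.

(** Recovers x and U from products of the coordinates and unit factors, so that they vary
    continuously along a path of points. *)
Lemma crit_ptK (R : realType) (s r : nat) (a : 'I_r -> nat) (t : R)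
    (D : DivT s r) (th : R) (x U : Cplx R) :
  reduced_eq s a t (div_class a D) th x U ->
  U = (\prod_j (crit_pt a D th x U).2 0 j) / e1 ((D (inr ord0))%:~R * th) /\
  forall i, x = U * e1 ((D (inl (lift ord0 i)))%:~R * th) * (crit_pt a D th x U).1 0 i.
Proof.
move=> [x0 U0 HU Hx]; split; last first.
  move=> i; rewrite mxE; have := e1_neq0 ((D (inl (lift ord0 i)))%:~R * th).
  by move=> e0; field; rewrite U0 e0.
rewrite prod_crit_pt2.
move: HU; rewrite e1N e1_class2; set Dl := \prod_j _.
have Dl0 : Dl != 0 by apply/prodf_neq0 => j _; exact: e1_neq0.
have M0 := e1_neq0 ((D (inr ord0))%:~R * th).
move/(congr1 (fun y => y / U ^+ r)); rewrite exprS mulfK ?expf_neq0// => HU.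
by rewrite {1}HU; field; rewrite Dl0 M0 expf_neq0.
Qed.

(** At [crit_pt] the critical equations hold once the terms of v_0 and e_0 have the values x / U and
    1 / U, and the reduced equations express exactly this. *)
Lemma Crit_gamma_param (R : realType) (s r : nat) (a : 'I_r -> nat) (t : R)
    (D : DivT s r) (th : R) (p : coords R s r) : (\sum_j a j <= s)%N ->
  Crit (gamma a t D th) p <->
  exists x U, reduced_eq s a t (div_class a D) th x U /\ p = crit_pt a D th x U.
Proof.
move=> As; set A := (\sum_j a j)%N; set B := (s.+1 - A)%N.
have BA (U : Cplx R) : U ^+ B * U ^+ A = U ^+ s * U.
  by rewrite -exprD subnK ?exprSr//; exact: leqW.
have T0 : real_complex R (expR t) != 0 :> Cplx R.
  by rewrite (_ : 0 = real_complex R 0)// (inj_eq (@complexI R)) gt_eqF// expR_gt0.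
have E0 := e1_neq0 ((D (inl ord0))%:~R * th).
have M0 := e1_neq0 ((D (inr ord0))%:~R * th).
have Ep0 : \prod_i e1 ((D (inl (lift ord0 i)))%:~R * th) != 0.
  by apply/prodf_neq0 => i _; exact: e1_neq0.
have Dl0 : \prod_j e1 ((D (inr (lift ord0 j)))%:~R * th) != 0.
  by apply/prodf_neq0 => i _; exact: e1_neq0.
have Da0 : \prod_j e1 ((D (inr (lift ord0 j)))%:~R * th) ^+ a j != 0.
  by apply/prodf_neq0 => i _; rewrite expf_neq0// e1_neq0.
have PQ x U : x != 0 -> U != 0 -> (weight_poly R a (fun=> 1%N)).[x] != 0 ->
    reduced_eq s a t (div_class a D) th x U <->
    real_complex R (expR t) * e1 ((D (inl ord0))%:~R * th) *
      ((\prod_j (crit_pt a D th x U).2 0 j ^+ a j) / \prod_i (crit_pt a D th x U).1 0 i)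
      = x / U /\
    e1 ((D (inr ord0))%:~R * th) / \prod_j (crit_pt a D th x U).2 0 j = U^-1.
  move=> x0 U0 G10; rewrite /reduced_eq prod_crit_pt2 prod_crit_pt prod_crit_pt1.
  rewrite e1N e1_class1 e1_class2 -/A -/B !exprS.
  move: E0 M0 Ep0 Dl0 Da0 G10 T0 (BA U).
  have Us0 : U ^+ s != 0 by rewrite expf_neq0.
  have Ur0 : U ^+ r != 0 by rewrite expf_neq0.
  have UA0 : U ^+ A != 0 by rewrite expf_neq0.
  have UB0 : U ^+ B != 0 by rewrite expf_neq0.
  have xs0 : x ^+ s != 0 by rewrite expf_neq0.
  move: Us0 Ur0 UA0 UB0 xs0.
  move: (U ^+ s) (U ^+ r) (U ^+ A) (U ^+ B) (x ^+ s) => Us Ur UA UB xs.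
  move: (e1 _) (e1 _) (\prod_i e1 _) (\prod_j e1 _) (\prod_j e1 _ ^+ a j) => M E Dl Ep Da.
  move: (weight_poly R a a).[x] (weight_poly R a _).[x] (real_complex R _ : Cplx R) => G2 G1 T.
  move=> Us0 Ur0 UA0 UB0 xs0 E0' M0' Ep0' Dl0' Da0' G10' T0' HBA.
  (* Powers and products are now independent variables for [field]; the relation U^B U^A = U^s U,
     from A + B = s + 1, eliminates U^B. *)
  have UBE : UB = Us * U / UA by rewrite -HBA mulfK.
  rewrite UBE; split=> [[_ _ H1 H2]|[H1 H2]]; split=> //.
  - have -> : x / U = x * xs / (xs * U) by field; rewrite U0 xs0.
    by rewrite H2; field; rewrite ?U0 ?xs0 ?UA0 ?Ep0' ?Us0 ?Da0'.
  - have -> : U^-1 = Ur / (U * Ur) by field; rewrite U0 Ur0.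
    by rewrite H1; field; rewrite ?U0 ?Ur0 ?G10' ?Dl0' ?M0'.
  - have -> : U * Ur = Ur / U^-1 by rewrite invrK mulrC.
    by rewrite -H2; field; rewrite ?U0 ?Ur0 ?G10' ?Dl0' ?M0'.
  - have -> : x * xs = (x / U) * (xs * U) by field.
    by rewrite -H1; field; rewrite ?U0 ?xs0 ?UA0 ?Ep0' ?Us0 ?Da0'.
case: p => z w; split=> [/Crit_gamma|[x [U [red ->]]]].
  set P := real_complex R _ * _ * _; set Q := e1 _ / _.
  move=> [z0 w0 Hz Hw].
  have pz0 : \prod_i z 0 i != 0 by apply/prodf_neq0 => i _.
  have pw0 : \prod_j w 0 j != 0 by apply/prodf_neq0 => i _.
  have Q0 : Q != 0 by rewrite mulf_neq0// invr_eq0.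
  have P0 : P != 0.
    rewrite !mulf_neq0 ?invr_eq0//.
    by apply/prodf_neq0 => j _; rewrite expf_neq0.
  have pE : (z, w) = crit_pt a D th (P / Q) Q^-1.
    congr pair; apply/rowP => j; rewrite mxE invrK.
      by rewrite -(Hz j) divfK// mulrAC mulfV ?mul1r// e1_neq0.
    have -> : (1 - (a j)%:R * (P / Q)) * Q = Q - (a j)%:R * P by field.
    by rewrite -(Hw j) addrK mulrAC mulfV ?mul1r// e1_neq0.
  have [zE wE] : z = (crit_pt a D th (P / Q) Q^-1).1 /\ w = (crit_pt a D th (P / Q) Q^-1).2.
    by rewrite -pE.
  exists (P / Q), Q^-1; split=> //; apply/PQ.
  - by rewrite mulf_neq0// invr_eq0.
  - by rewrite invr_eq0.
  - by move: pw0; rewrite wE prod_crit_pt2 mulf_eq0 negb_or => /andP[].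
  - by rewrite -wE -zE invrK -/P -/Q divfK.
have [x0 U0 HU Hx] := red.
(* U is nonzero, hence so is g1(x); no factor 1 - a_j x vanishes, which makes every w_j nonzero. *)
have G10 : (weight_poly R a (fun=> 1%N)).[x] != 0.
  have : U ^+ r.+1 != 0 by rewrite expf_neq0.
  by rewrite HU mulf_eq0 negb_or => /andP[].
have /PQ[//|//|//|HP HQ] := red.
apply/Crit_gamma; rewrite HP HQ; split=> [i|j|i|j].
- by rewrite mxE !mulf_neq0 ?invr_eq0 ?e1_neq0.
- rewrite mxE !mulf_neq0 ?invr_eq0 ?e1_neq0//.
  move: G10; rewrite horner_weight_poly => /prodf_neq0/(_ j isT).
  by rewrite expr1.
- by rewrite mxE mulrC divfK// e1_neq0.
- rewrite mxE mulrC divfK ?e1_neq0//; by field.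
Qed.

(** * Labels of critical points *)

Lemma cabs_unity_root (R : realType) n (z : Cplx R) : z ^+ n.+1 = 1 -> cabs z = 1.
Proof.
move=> /(congr1 (@cabs R)); rewrite cabsX cabs1 => /eqP.
by rewrite pexprn_eq1 ?cabs_ge0// => /eqP.
Qed.

(* [lam] and [c] are the leading terms of [U] and [x] in [reduced_eq]. *)
Definition label (R : realType) (s r : nat) (a : 'I_r -> nat) (t : R) (d : Pic)
    (th : R) (lam c : Cplx R) : Prop :=
  lam ^+ r.+1 = e1 (- (d.2%:~R * th)) /\
  c ^+ s.+1 = real_complex R (expR t) * e1 (d.1%:~R * th) *
    lam ^+ (s.+1 - \sum_j a j).

Lemma label_neq0 (R : realType) (s r : nat) (a : 'I_r -> nat) (t : R) (d : Pic)
    (th : R) (lam c : Cplx R) :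
  label s a t d th lam c -> lam != 0 /\ c != 0.
Proof.
move=> [hl hc]; have lam0 : lam != 0.
  have : lam ^+ r.+1 != 0 by rewrite hl e1_neq0.
  by rewrite expf_eq0.
split=> //; have : c ^+ s.+1 != 0; last by rewrite expf_eq0.
rewrite hc mulf_neq0 ?expf_neq0// mulf_neq0 ?e1_neq0//.
by rewrite (_ : 0 = real_complex R 0)// (inj_eq (@complexI R)) gt_eqF// expR_gt0.
Qed.

Lemma cabs_label (R : realType) (s r : nat) (a : 'I_r -> nat) (t : R) (d : Pic)
    (th : R) (lam c : Cplx R) :
  label s a t d th lam c -> cabs c ^+ s.+1 = expR t.
Proof.
move=> [hl hc]; have l1 : cabs lam = 1.
  apply/eqP; have : cabs lam ^+ r.+1 == 1 by rewrite -cabsX hl cabs_e1.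
  by rewrite pexprn_eq1 ?cabs_ge0.
by rewrite -cabsX hc cabsM cabsX l1 expr1n mulr1 cabs_e1M ?expR_ge0.
Qed.

(** The data serve all classes [d], all loop parameters [th] and all t < [T] at once, which yields
    one bound on t for every divisor. [chart_rigid] lets both [tau] and [th] vary, so as to cover
    branches and loops. *)
Record chart (R : realType) (s r : nat) (a : 'I_r -> nat) (T c0 : R)
    (Y V : Cplx R -> Cplx R) : Prop := Chart {
  chart_gt0 : 0 < c0;
  chart_sol : forall c, cabs c < c0 ->
    [/\ scaled_sol (weight_poly R a (fun=> 1%N)) (weight_poly R a a)
          r.+1 s.+1 (s.+1 - \sum_j a j) c (Y c) (V c), Y c != 0 & V c != 0];
  chart_cvg : forall c, cabs c < c0 ->
    {for c, continuous Y} /\ {for c, continuous V};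
  chart0 : Y 0 = 1 /\ V 0 = 1;
  chart_small : forall t d th lam c, t < T ->
    label s a t d th lam c -> cabs c < c0;
  chart_label : forall t d th x U, t < T -> reduced_eq s a t d th x U ->
    exists lam c, [/\ label s a t d th lam c, U = lam * V c & x = c * Y c];
  chart_rigid : forall (I : set R) (tau th : R -> R) d (x U lam C : R -> Cplx R) u0,
    is_interval I -> I u0 -> (forall u, I u -> tau u < T) ->
    {within I, continuous x} -> {within I, continuous U} ->
    {within I, continuous lam} -> {within I, continuous C} ->
    (forall u, I u -> reduced_eq s a (tau u) d (th u) (x u) (U u)) ->
    (forall u, I u -> label s a (tau u) d (th u) (lam u) (C u)) ->
    U u0 = lam u0 * V (C u0) -> x u0 = C u0 * Y (C u0) ->
    forall u, I u -> U u = lam u * V (C u) /\ x u = C u * Y (C u)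
}.

Lemma reduced_eq_label (R : realType) (s r : nat) (a : 'I_r -> nat) (T c0 : R)
    (Y V : Cplx R -> Cplx R) (t : R) (d : Pic) (th : R) (lam c : Cplx R) :
  chart s a T c0 Y V -> t < T -> label s a t d th lam c ->
  reduced_eq s a t d th (c * Y c) (lam * V c).
Proof.
move=> ch tT L; have [lam0 c_neq0] := label_neq0 L.
have [[Vn Ym] Y0 V0] := chart_sol ch (chart_small ch tT L); have [hl hc] := L.
split; rewrite ?mulf_neq0//; rewrite exprMn ?hl ?Vn//.
by rewrite hc Ym exprMn; ring.
Qed.

Lemma within_continuous_div (R : realType) (I : set R) (f g : R -> Cplx R) :
  {within I, continuous f} -> {within I, continuous g} ->
  (forall u, I u -> g u != 0) -> {within I, continuous (fun u => f u / g u)}.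
Proof.
move=> /subspace_continuousP fI /subspace_continuousP gI g0.
apply/subspace_continuousP => u Iu; apply: cvgM; first exact: fI.
by apply: cvgV; [exact: g0|exact: gI].
Qed.

Lemma chart_exists (R : realType) (s r : nat) (a : 'I_r -> nat) :
  (\sum_j a j <= s)%N -> exists T c0 Y V, @chart R s r a T c0 Y V.
Proof.
move=> As; have [en en0 hn] := @near_unity_path R r.+1 isT.
have [em em0 hm] := @near_unity_path R s.+1 isT.
(* Corrections closer to 1 than [en] and [em] allow [near_unity_path] to separate labels; at
   distance below 1 from 1 they are nonzero. *)
pose d0 := Num.min 1 (Num.min en em).
have d00 : 0 < d0 by rewrite !lt_min ltr01 en0.
have g10 := weight_poly0 R a (fun=> 1%N); have g20 := weight_poly0 R a a.
have sg := size_weight_polyM R As.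
have [d [c0 [Y [V [/andP[d_gt0 dd0] c00 hsol huniq hcvg]]]]] :=
  small_solutions (isT : 0 < r.+1)%N (isT : 0 < s.+1)%N g10 g20 sg d00.
have [k0 k00 hlab] := labels_exist (isT : 0 < r.+1)%N (isT : 0 < s.+1)%N g10 g20 sg d_gt0.
have [d1 den dem] : [/\ d <= 1, d <= en & d <= em].
  by move: dd0; rewrite !le_min => /and3P[].
(* e^t < k0 gives labels by [labels_exist]; e^t < c0^(s+1) puts c in the disc of [Y] and [V], since
   |c|^(s+1) = e^t. *)
pose M := Num.min k0 (c0 ^+ s.+1).
have M0 : 0 < M by rewrite lt_min k00 exprn_gt0.
have small t dd th lam c : t < ln M -> label s a t dd th lam c -> cabs c < c0.
  move=> tT /cabs_label hc; rewrite -(@ltr_pXn2r _ s.+1) ?nnegrE ?cabs_ge0 ?(ltW c00)//.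
  move: tT; rewrite -ltr_expR lnK ?posrE// lt_min hc => /andP[_]; exact.
have labels t dd th x U : t < ln M -> reduced_eq s a t dd th x U ->
    exists lam c, [/\ label s a t dd th lam c, U = lam * V c & x = c * Y c].
  move=> tT [x0 U0 HU Hx].
  have [|||||lam [c [y [v [[hl hc Uv xy] [yd vd S]]]]]] := hlab x U
     (real_complex R (expR t) * e1 (dd.1%:~R * th)) (e1 (- (dd.2%:~R * th))) => //.
  - rewrite cabs_e1M ?expR_ge0//.
    by move: tT; rewrite -ltr_expR lnK ?posrE// lt_min => /andP[].
  - exact: cabs_e1.
  have L : label s a t dd th lam c by [].
  have [yY vV] := huniq _ _ _ (small _ _ _ _ _ tT L) yd vd S.
  by exists lam, c; rewrite -yY -vV.
exists (ln M), c0, Y, V; split => //.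
- move=> c /hsol[S Yd Vd]; split => //; apply: near1_neq0;
    by apply: lt_le_trans d1.
- have [||||-> ->] := huniq 0 1 1 => //; rewrite ?cabs0 ?subrr ?cabs0//.
  by split; rewrite mul0r ?g10 ?g20 ?expr1n ?mulr1.
move=> I tau th dd x U lam C u0 itvI Iu0 tauT xI UI lamI CI hred hL Uu0 xu0 u Iu.
have lam0 v : I v -> lam v != 0 by move=> /hL/label_neq0[].
have C0 v : I v -> C v != 0 by move=> /hL/label_neq0[].
have CV v : I v -> cabs (1 - V (C v)) < d /\ cabs (1 - Y (C v)) < d.
  by move=> Iv; have [_ ? ?] := hsol _ (small _ _ _ _ _ (tauT _ Iv) (hL _ Iv)).
(* The ratio l / lam is an (r+1)-th root of unity at distance |1 - V| from the continuous function U
   / lam, which is near 1 at [u0]; so the ratio is 1 all along [I]. *)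
have lamE v l c : I v -> label s a (tau v) dd (th v) l c -> U v = l * V c -> l = lam v.
  move=> Iv L Uv.
  have omE v' l' c' : I v' -> label s a (tau v') dd (th v') l' c' -> U v' = l' * V c' ->
      (l' / lam v') ^+ r.+1 = 1 /\ cabs (l' / lam v' - U v' / lam v') < en.
    move=> Iv' [hl hc] Uv'; have [hl' _] := hL _ Iv'.
    have om1 : (l' / lam v') ^+ r.+1 = 1 by rewrite exprMn exprVn hl hl' mulfV ?e1_neq0.
    split=> //; rewrite Uv' -mulrBl -{1}[l']mulr1 -mulrBr mulrAC cabsM.
    have -> : cabs (l' / lam v') = 1.
      exact: cabs_unity_root om1.
    rewrite mul1r; have [_ _ Vd] := hsol _ (small _ _ _ _ _ (tauT _ Iv') (conj hl hc)).
    exact: lt_le_trans den.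
  have [om1 om2] := omE _ _ _ Iv L Uv.
  suff om : l / lam v = 1 by rewrite -[l](divfK (lam0 _ Iv)) om mul1r.
  apply: (hn I (fun v => U v / lam v) u0 itvI _ _ Iu0 _ v _ Iv om1 om2).
  - exact: within_continuous_div.
  - move=> v' Iv'; have [l' [c' [L' Uv' _]]] := labels _ _ _ _ _ (tauT _ Iv') (hred _ Iv').
    by exists (l' / lam v'); have [] := omE _ _ _ Iv' L' Uv'.
  - rewrite Uu0 mulrAC mulfV ?lam0// mul1r.
    by apply: lt_le_trans den; have [] := CV _ Iu0.
(* Once the first entries agree, c and [C v] have the same (s+1)-th power, and the same argument
   applies to x / C. *)
have cE v l c : I v -> label s a (tau v) dd (th v) l c -> U v = l * V c -> x v = c * Y c ->
    c = C v.
  move=> Iv L Uv xv.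
  have omE v' l' c' : I v' -> label s a (tau v') dd (th v') l' c' -> U v' = l' * V c' ->
      x v' = c' * Y c' ->
      (c' / C v') ^+ s.+1 = 1 /\ cabs (c' / C v' - x v' / C v') < em.
    move=> Iv' L' Uv' xv'; have ll := lamE _ _ _ Iv' L' Uv'.
    have [hl hc] := L'; have [hl' hc'] := hL _ Iv'.
    have om1 : (c' / C v') ^+ s.+1 = 1.
      have Cs : C v' ^+ s.+1 != 0 by rewrite expf_neq0// C0.
      by rewrite exprMn exprVn hc ll -hc' mulfV.
    split=> //; rewrite xv' -mulrBl -{1}[c']mulr1 -mulrBr mulrAC cabsM.
    have -> : cabs (c' / C v') = 1.
      exact: cabs_unity_root om1.
    rewrite mul1r; have [_ Yd _] := hsol _ (small _ _ _ _ _ (tauT _ Iv') L').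
    exact: lt_le_trans dem.
  have [om1 om2] := omE _ _ _ Iv L Uv xv.
  suff om : c / C v = 1 by rewrite -[c](divfK (C0 _ Iv)) om mul1r.
  apply: (hm I (fun v => x v / C v) u0 itvI _ _ Iu0 _ v _ Iv om1 om2).
  - exact: within_continuous_div.
  - move=> v' Iv'; have [l' [c' [L' Uv' xv']]] := labels _ _ _ _ _ (tauT _ Iv') (hred _ Iv').
    by exists (c' / C v'); have [] := omE _ _ _ Iv' L' Uv' xv'.
  - rewrite xu0 mulrAC mulfV ?C0// mul1r.
    by apply: lt_le_trans dem; have [] := CV _ Iu0.
have [l [c [L Uu xu]]] := labels _ _ _ _ _ (tauT _ Iu) (hred _ Iu).
by rewrite -(lamE _ _ _ Iu L Uu) -(cE _ _ _ Iu L Uu xu).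
Qed.

(* The label of the branch (k, l) is [al = l], [be = k]; real values of [al] and
   [be] interpolate between the integers along a loop. *)
Definition std_lam (R : realType) (r : nat) (al : R) : Cplx R :=
  e1 (- (al / r.+1%:R)).

(** The first two summands of the angle are the limiting angle of z_i on the branch; the last is the
    angle of [std_lam]. Their sum is the angle of the leading term of x = z_i U at [th = 0]. *)
Definition std_c (R : realType) (s r : nat) (a : 'I_r -> nat) (t al be : R) :
    Cplx R :=
  real_complex R (expR (t / s.+1%:R)) *
  e1 (al * (\sum_j a j)%:R / (s.+1%:R * r.+1%:R) + be / s.+1%:R - al / r.+1%:R).

(** The angle of [std_c] times s + 1 is be - B al / (r + 1), with B = s + 1 - A. The turning of the
    parameters is thus absorbed by al and be moving linearly in th, while the integers k and l
    disappear under [e1]. *)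
Lemma label_std (R : realType) (s r : nat) (a : 'I_r -> nat) (t : R) (d : Pic)
    (th : R) (k l : int) : (\sum_j a j <= s)%N ->
  label s a t d th (std_lam r (l%:~R + d.2%:~R * th))
    (std_c s a t (l%:~R + d.2%:~R * th) (k%:~R + d.1%:~R * th)).
Proof.
move=> As; set al := l%:~R + _; set be := k%:~R + _.
have n0 : r.+1%:R != 0 :> R by rewrite pnatr_eq0.
have m0 : s.+1%:R != 0 :> R by rewrite pnatr_eq0.
split; rewrite /std_lam /std_c ?exprMn -!e1Mn.
  have -> : r.+1%:R * - (al / r.+1%:R) = - (d.2%:~R * th) + (- l)%:~R.
    by rewrite mulrN mulrC divfK// /al mulrNz; ring.
  by rewrite e1D e1_int mulr1.
have -> : (real_complex R (expR (t / s.+1%:R)) : Cplx R) ^+ s.+1 =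
    real_complex R (expR t).
  by rewrite -rmorphXn /= -expRM_natl mulrC divfK.
rewrite -[RHS]mulrA -e1D; congr (_ * _).
have mE : s.+1%:R = (\sum_j a j)%:R + (s.+1 - \sum_j a j)%:R :> R.
  by rewrite -natrD subnKC//; exact: leqW.
set A := (\sum_j a j)%:R in mE *; set B := (s.+1 - _)%:R in mE *.
rewrite -[LHS]mulr1 -(e1_int R (- k)) -e1D mulrNz; congr (e1 _).
have -> : B = s.+1%:R - A by rewrite mE addrC addKr.
rewrite /be; clear mE; move: n0 m0.
by move: (r.+1%:R : R) (s.+1%:R : R) => N M N0 M0; field; rewrite N0 M0.
Qed.

Lemma std_cD (R : realType) (s r : nat) (a : 'I_r -> nat) (t al be : R) :
  std_c s a t al be = std_c s a t al 0 * e1 (be / s.+1%:R).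
Proof.
rewrite /std_c -[RHS]mulrA -e1D; congr (_ * e1 _).
by rewrite mul0r addr0 addrAC.
Qed.

(** The inverse of lam is an (r+1)-th root of unity, which gives l; the ratio of c to the standard
    value for this lam is an (s+1)-th root of unity, which gives k. *)
Lemma label_std_exists (R : realType) (s r : nat) (a : 'I_r -> nat) (t : R)
    (d : Pic) (lam c : Cplx R) : (\sum_j a j <= s)%N ->
  label s a t d 0 lam c -> exists (k : 'I_s.+1) (l : 'I_r.+1),
    lam = std_lam r l%:R /\ c = std_c s a t l%:R k%:R.
Proof.
move=> As L; have [lam0 _] := label_neq0 L; have [hl hc] := L.
have [l hlam] : exists l : 'I_r.+1, lam^-1 = e1 (l%:R / r.+1%:R).
  by apply: unity_root_e1 => //; rewrite exprVn hl mulr0 oppr0 e1_0 invr1.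
have lamE : lam = std_lam r l%:R by rewrite /std_lam e1N -hlam invrK.
have L0 := label_std t d 0 0 l%:Z As.
rewrite !mulr0 !addr0 [(l%:Z)%:~R]/= mulr0z -pmulrn -lamE in L0.
have [_ c0] := label_neq0 L0; have [_ hc0] := L0.
have [k hk] : exists k : 'I_s.+1, c / std_c s a t l%:R 0 = e1 (k%:R / s.+1%:R).
  apply: unity_root_e1 => //; rewrite exprMn exprVn hc -hc0 mulfV//.
  by rewrite expf_neq0.
by exists k, l; split=> //; rewrite std_cD -hk mulrC divfK.
Qed.

Lemma cabs_std_c (R : realType) (s r : nat) (a : 'I_r -> nat) (t al be : R) :
  cabs (std_c s a t al be) = expR (t / s.+1%:R).
Proof. by rewrite cabs_e1M// expR_ge0. Qed.

(** * Continuity of the standard labels and limits of arguments *)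

Lemma continuous_e1_comp (R : realType) (f : R -> R) u :
  {for u, continuous f} -> {for u, continuous (fun v => e1 (f v))}.
Proof.
by move=> cf; apply: (@continuous_comp R R (Cplx R) f (@e1 R)) => //; exact: continuous_e1.
Qed.

Lemma continuous_std_lam (R : realType) (r : nat) (al : R -> R) u :
  {for u, continuous al} -> {for u, continuous (fun v => std_lam r (al v))}.
Proof.
move=> cal; apply: continuous_e1_comp.
by apply: cvgN; apply: cvgM => //; exact: cvg_cst.
Qed.

Lemma continuous_std_c (R : realType) (s r : nat) (a : 'I_r -> nat)
    (tau al be : R -> R) u :
  {for u, continuous tau} -> {for u, continuous al} -> {for u, continuous be} ->
  {for u, continuous (fun v => std_c s a (tau v) (al v) (be v))}.
Proof.
move=> ct cal cbe; have cc (x : R) : (fun=> x) v @[v --> u] --> x by exact: cvg_cst.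
apply: cvgM.
  apply: (@continuous_comp R R (Cplx R) (fun v => expR (tau v / s.+1%:R))
    (real_complex R)); last exact: continuous_real_complex.
  apply: (@continuous_comp R R R (fun v => tau v / s.+1%:R) expR).
    exact: (cvgM ct (cc _)).
  exact: continuous_expR.
apply: (@continuous_e1_comp R (fun v => al v * (\sum_j a j)%:R /
  (s.+1%:R * r.+1%:R) + be v / s.+1%:R - al v / r.+1%:R) u).
apply: cvgB; last exact: (cvgM cal (cc _)).
apply: cvgD; last exact: (cvgM cbe (cc _)).
exact: (cvgM (cvgM cal (cc _)) (cc _)).
Qed.

Lemma cvg_row (R : realType) (T : Type) (F : set_system T) (FF : Filter F) n
    (f : T -> 'rV[Cplx R]_n) (M : 'rV[Cplx R]_n) :
  (forall i, (fun u => f u 0 i) @ F --> M 0 i) -> f @ F --> M.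
Proof.
move=> fM; apply/cvg_ballP => e e0.
have : \forall u \near F, forall i, ball (M 0 i) e (f u 0 i).
  by apply: filter_forall => i; move: (fM i) => /cvg_ballP; exact.
by apply: filterS => u hu; split=> // i j; rewrite ord1; exact: hu.
Qed.

(** Division by the positive [rho] keeps arguments. At some time the normalised value is close to e1
    be and has an argument th close to al; its modulus being near 1, it is also close to e1 th, so
    e1 al and e1 be are arbitrarily close. *)
Lemma Arg_cvg_unique (R : realType) (f : R -> Cplx R) (rho : R -> R) (al be : R) :
  (forall u, 0 < rho u) ->
  (fun u => f u / real_complex R (rho u)) u @[u --> -oo] --> e1 be ->
  Arg_cvg_ninfty f al -> e1 al = e1 be.
Proof.
move=> rho0 fbe fal; apply/eqP; rewrite -subr_eq0 -cabs_eq0; apply/eqP.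
apply/eqP; rewrite eq_le cabs_ge0 andbT; apply/ler_addgt0Pr => e e0; rewrite add0r.
have e3 : 0 < e / 3 by lra.
have U : nbhs al [set th | cabs (e1 al - e1 th) < e / 3].
  exact: (cvg_cabsP (nbhs_filter al) (@e1 R) (e1 al)).1 (@continuous_e1 R al) _ e3.
have FF : Filter (ninfty_nbhs R) by exact: _.
have near_be := (cvg_cabsP FF _ _).1 fbe _ e3.
have [u [hu [th [hth Uth]]]] := filter_ex (filterI near_be (fal _ U)).
set y := f u / _ in hu; rewrite /Arg /= in hth.
pose rhoC : Cplx R := real_complex R (rho u).
have rhoC0 : rhoC != 0 by rewrite -cabs_eq0 cabs_real gt_eqF// normr_gt0 gt_eqF.
have yE : y = `|y| * e1 th.
  have rhoCn : `|rhoC| = rhoC by rewrite -cabsE cabs_real gtr0_norm.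
  by rewrite /y -/rhoC {1}hth normrM normfV rhoCn mulrAC.
have hn : cabs (y - e1 th) < e / 3.
  have -> : y - e1 th = real_complex R (cabs y - 1) * e1 th.
    by rewrite {1}yE -cabsE rmorphB rmorph1 mulrBl mul1r.
  rewrite cabsM cabs_e1 mulr1 cabs_real ltr_norml.
  have := cabs_dist y (e1 be); have := cabs_dist (e1 be) y.
  by rewrite cabs_e1 [cabs (y - _)]cabsB; lra.
rewrite /= in Uth.
have -> : e1 al - e1 be = (e1 al - e1 th) + ((e1 th - y) + (y - e1 be)) by ring.
have := cabsD (e1 al - e1 th) ((e1 th - y) + (y - e1 be)).
have := cabsD (e1 th - y) (y - e1 be).
by rewrite [cabs (e1 th - y)]cabsB [cabs (y - e1 be)]cabsB; lra.
Qed.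

Lemma cabs_sqr (R : realType) (x y : R) :
  cabs (Complex x y : Cplx R) ^+ 2 = x ^+ 2 + y ^+ 2.
Proof.
apply: (@complexI R); rewrite rmorphXn /= cabsE.
by rewrite -(add_Re2_Im2 (Complex x y)).
Qed.

Lemma polar_near1 (R : realType) (e : R) : 0 < e ->
  exists2 d : R, 0 < d & forall y : Cplx R, cabs (1 - y) < d ->
    exists2 th : R, `|th| < e & y = `|y| * e1 th.
Proof.
move=> e0; have pi0 := pi_gt0 R.
have as0 : asin (0 : R) = 0.
  by rewrite -[in LHS]sin0 sinK// in_itv /= oppr_le0 divr_ge0 ?pi_ge0.
have : \forall b \near (0 : R), `|asin b| < 2 * pi * e.
  have e1' : 0 < 2 * pi * e by rewrite !mulr_gt0.
  have : {for (0 : R), continuous (@asin R)}.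
    by apply: continuous_asin; rewrite ltrN10 ltr01.
  move=> /cvgrPdist_lt/(_ _ e1'); apply: filterS => b.
  by rewrite as0 sub0r normrN.
move=> /nbhs_ballP[dl dl0 hdl]; exists (Num.min 2^-1 (dl / 2)); first by rewrite lt_min divr_gt0// andbT.
move=> y; rewrite lt_min => /andP[y1 y2].
have y0 : y != 0 by apply: near1_neq0; lra.
have cy := cabs_near1 y1; have cy0 : 0 < cabs y by lra.
pose v := y / real_complex R (cabs y).
have [al [be vE]] : exists al be, v = Complex al be by case: v => al be; exists al, be.
have v1 : cabs v = 1.
  by rewrite cabsM cabsV cabs_real ger0_norm ?cabs_ge0// mulfV// gt_eqF.
have yv : y = real_complex R (cabs y) * v.
  by rewrite /v mulrC divfK// -cabs_eq0 cabs_real normr_eq0 gt_eqF.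
have dv : cabs (1 - v) <= 2 * cabs (1 - y).
  have -> : 1 - v = (1 - y) + real_complex R (cabs y - 1) * v.
    by rewrite {1}yv rmorphB rmorph1; ring.
  apply: le_trans (cabsD _ _) _; rewrite cabsM v1 mulr1 cabs_real.
  suff : `|cabs y - 1| <= cabs (1 - y) by lra.
  have := cabs_dist y 1; have := cabs_dist 1 y.
  by rewrite cabs1 [cabs (y - 1)]cabsB ler_norml; lra.
have sq1 := cabs_sqr al be; rewrite -vE v1 expr1n in sq1.
have sq2 := cabs_sqr (1 - al) (- be).
have vE2 : Complex (1 - al) (- be) = 1 - v.
  by rewrite vE; apply/eqP; rewrite eq_complex /= sub0r !eqxx.
rewrite vE2 sqrrN in sq2; have dv0 := cabs_ge0 (1 - v).
(* |1 - v| < 1 puts v on the right half of the unit circle, where the arcsine of the imaginary part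
   is an argument, small with that part. *)
have al0 : 0 < al by nra.
have be_dl : `|be| < dl.
  rewrite ltr_norml; move: y2; rewrite ltr_pdivlMr// => y2; nra.
have be1 : -1 <= be <= 1 by nra.
exists (asin be / (2 * pi)).
  rewrite normrM normfV ltr_pdivrMr ?normr_gt0 ?gt_eqF ?mulr_gt0//.
  rewrite [`|2 * pi|]ger0_norm ?mulr_ge0 ?pi_ge0// mulrC.
  by apply: hdl; rewrite /ball /= sub0r normrN.
rewrite -cabsE {1}yv vE; congr (_ * _).
rewrite /e1 (_ : 2 * pi * (asin be / (2 * pi)) = asin be); last first.
  by rewrite mulrC divfK// gt_eqF// mulr_gt0.
rewrite cos_asin// asinK ?in_itv//=.
by rewrite (_ : 1 - be ^+ 2 = al ^+ 2) ?sqrtr_sqr ?gtr0_norm// sq1 addrK.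
Qed.

(** The small argument that [polar_near1] gives to f / (rho e1 be), added to be, is an argument of
    f. *)
Lemma Arg_cvg_of_cvg (R : realType) (f : R -> Cplx R) (rho : R -> R) (be : R) :
  (forall u, 0 < rho u) ->
  (fun u => f u / real_complex R (rho u)) u @[u --> -oo] --> e1 be ->
  Arg_cvg_ninfty f be.
Proof.
move=> rho0 fbe U /nbhs_ballP[e /= e0 eU].
have FF : Filter (ninfty_nbhs R) by exact: _.
have [d d0 hd] := polar_near1 e0.
have := (cvg_cabsP FF _ _).1 fbe _ d0; apply: filterS => u hu.
pose rhoC : Cplx R := real_complex R (rho u).
have rhoC0 : rhoC != 0 by rewrite -cabs_eq0 cabs_real gt_eqF// normr_gt0 gt_eqF.
have rhoCn : `|rhoC| = rhoC by rewrite -cabsE cabs_real gtr0_norm.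
have [|th th_e hth] := hd (f u / rhoC / e1 be).
  have -> : 1 - f u / rhoC / e1 be = (e1 be - f u / rhoC) / e1 be.
    by rewrite mulrBl mulfV ?e1_neq0.
  by rewrite cabsM cabsV cabs_e1 invr1 mulr1.
exists (be + th); split; last first.
  by apply: eU; rewrite /ball /= opprD addNKr normrN.
rewrite /Arg /= e1D; have fE : f u = f u / rhoC / e1 be * e1 be * rhoC.
  by rewrite !divfK ?e1_neq0.
rewrite {1}fE hth !normrM !normfV rhoCn.
have -> : `|e1 be| = 1 by rewrite -cabsE cabs_e1.
by field.
Qed.

Lemma cvg_std_c (R : realType) (s r : nat) (a : 'I_r -> nat) (al be : R) :
  (fun u => std_c s a u al be) u @[u --> -oo] --> (0 : Cplx R).
Proof.
have FF : Filter (ninfty_nbhs R) by exact: _.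
apply: (cvg_cabsP FF _ _).2 => e e0.
exists (s.+1%:R * ln e); split; first exact: num_real.
move=> u ue; rewrite sub0r cabsN cabs_std_c -[ltRHS](lnK (x := e))// ltr_expR.
by rewrite ltr_pdivrMr// mulrC.
Qed.

(** * Branches and monodromy *)

(** At [th = 0], [al = l] and [be = k] this is the point of the branch (k, l) at time t; real [al]
    and [be] let it follow a loop. The parameter belonging to l comes first. *)
Definition std_pt (R : realType) (s r : nat) (a : 'I_r -> nat) (D : DivT s r)
    (Y V : Cplx R -> Cplx R) (t th al be : R) : coords R s r :=
  crit_pt a D th (std_c s a t al be * Y (std_c s a t al be))
    (std_lam r al * V (std_c s a t al be)).

Lemma LG_gamma (R : realType) (s r : nat) (a : 'I_r -> nat) (t : R) (D : DivT s r) :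
  LG a t = gamma a t D 0.
Proof.
apply/funext => z; apply/funext => w; rewrite /LG /gamma !mulr0 e1_0 mulr1.
congr (_ + _ + _ + _ + _); apply: eq_bigr => i _; by rewrite mulr0 e1_0 mul1r.
Qed.

Lemma crit_pt_period (R : realType) (s r : nat) (a : 'I_r -> nat) (D : DivT s r)
    (x U : Cplx R) : crit_pt a D 1 x U = crit_pt a D 0 x U.
Proof.
by congr pair; apply/rowP => i; rewrite !mxE !mulr1 !mulr0 e1_0 e1_int.
Qed.

Lemma label_std0 (R : realType) (s r : nat) (a : 'I_r -> nat) (t : R) (d : Pic)
    (k l : nat) : (\sum_j a j <= s)%N ->
  label s a t d 0 (std_lam r l%:R) (std_c s a t l%:R k%:R).
Proof. by move=> As; have := label_std t d 0 k l As; rewrite !mulr0 !addr0. Qed.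

Lemma cvg_prod (R : realType) (T : Type) (F : set_system T) (FF : Filter F)
    (I : Type) (q : seq I) (f : I -> T -> Cplx R) (l : I -> Cplx R) :
  (forall i, f i @ F --> l i) ->
  (fun u => \prod_(i <- q) f i u) @ F --> \prod_(i <- q) l i.
Proof.
move=> fl; elim: q => [|i q IH].
  rewrite big_nil (_ : (fun u => _) = cst 1); first exact: cvg_cst.
  by apply/funext => u; rewrite big_nil.
rewrite big_cons (_ : (fun u => _) = (fun u => f i u * \prod_(i <- q) f i u)).
  exact: (cvgM (fl i) IH).
by apply/funext => u; rewrite big_cons.
Qed.

Lemma continuous_std_pt (R : realType) (s r : nat) (a : 'I_r -> nat) (D : DivT s r)
    (T c0 : R) (Y V : Cplx R -> Cplx R) (tau th al be : R -> R) u :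
  chart s a T c0 Y V -> cabs (std_c s a (tau u) (al u) (be u)) < c0 ->
  {for u, continuous tau} -> {for u, continuous th} ->
  {for u, continuous al} -> {for u, continuous be} ->
  {for u, continuous (fun v => std_pt a D Y V (tau v) (th v) (al v) (be v))}.
Proof.
move=> ch cc0 ctau cth cal cbe.
have [_ Y0 V0] := chart_sol ch cc0; have [cY cV] := chart_cvg ch cc0.
have cst1 (x : Cplx R) : (fun=> x) v @[v --> u] --> x by exact: cvg_cst.
have cstR (x : R) : (fun=> x) v @[v --> u] --> x by exact: cvg_cst.
pose C v := std_c s a (tau v) (al v) (be v).
have cC : {for u, continuous C} by exact: continuous_std_c.
have cYC : (fun v => Y (C v)) v @[v --> u] --> Y (C u).
  exact: (@continuous_comp R (Cplx R) (Cplx R) C Y u cC cY).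
have cVC : (fun v => V (C v)) v @[v --> u] --> V (C u).
  exact: (@continuous_comp R (Cplx R) (Cplx R) C V u cC cV).
have clam := @continuous_std_lam R r al u cal.
have lam0 : std_lam r (al u) != 0 by exact: e1_neq0.
have ce (N : R) : (fun v => e1 (N * th v)) v @[v --> u] --> e1 (N * th u).
  by apply: (@continuous_e1_comp R (fun v => N * th v) u); exact: (cvgM (cstR N) cth).
have cU : (fun v => (std_lam r (al v) * V (C v))^-1) v @[v --> u] -->
    (std_lam r (al u) * V (C u))^-1.
  by apply: cvgV; [rewrite mulf_neq0|exact: (cvgM clam cVC)].
have ceV (N : R) : (fun v => (e1 (N * th v))^-1) v @[v --> u] --> (e1 (N * th u))^-1.
  by apply: cvgV; [exact: e1_neq0|exact: ce].
have cx : (fun v => C v * Y (C v)) v @[v --> u] --> C u * Y (C u).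
  exact: (cvgM cC cYC).
pose P v := std_pt a D Y V (tau v) (th v) (al v) (be v).
have P1 : (fun v => (P v).1) v @[v --> u] --> (P u).1.
  apply: (cvg_row (nbhs_filter u)) => i.
  have -> : (fun v => (P v).1 0 i) = fun v => C v * Y (C v) *
      (std_lam r (al v) * V (C v))^-1 * (e1 ((D (inl (lift ord0 i)))%:~R * th v))^-1.
    by apply/funext => v; rewrite mxE.
  rewrite mxE; exact: (cvgM (cvgM cx cU) (ceV _)).
have P2 : (fun v => (P v).2) v @[v --> u] --> (P u).2.
  apply: (cvg_row (nbhs_filter u)) => i.
  have -> : (fun v => (P v).2 0 i) = fun v => (1 - (a i)%:R * (C v * Y (C v))) *
      (std_lam r (al v) * V (C v))^-1 * (e1 ((D (inr (lift ord0 i)))%:~R * th v))^-1.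
    by apply/funext => v; rewrite mxE.
  rewrite mxE; exact: (cvgM (cvgM (cvgB (cst1 1) (cvgM (cst1 _) cx)) cU) (ceV _)).
exact: (cvg_pair P1 P2).
Qed.

(** [crit_ptK] makes x and U continuous along the path, the standard labels are continuous by
    construction, and [chart_rigid] compares the two. *)
Lemma path_rigid (R : realType) (s r : nat) (a : 'I_r -> nat) (D : DivT s r)
    (T c0 : R) (Y V : Cplx R -> Cplx R) (I : set R) (tau th al be : R -> R)
    (p : R -> coords R s r) u0 : (1 <= s)%N -> (\sum_j a j <= s)%N ->
  chart s a T c0 Y V -> is_interval I -> I u0 ->
  continuous tau -> continuous th -> continuous al -> continuous be ->
  (forall u, I u -> tau u < T) ->
  (forall u, I u -> label s a (tau u) (div_class a D) (th u) (std_lam r (al u))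
     (std_c s a (tau u) (al u) (be u))) ->
  {within I, continuous p} ->
  (forall u, I u -> Crit (gamma a (tau u) D (th u)) (p u)) ->
  p u0 = std_pt a D Y V (tau u0) (th u0) (al u0) (be u0) ->
  forall u, I u -> p u = std_pt a D Y V (tau u) (th u) (al u) (be u).
Proof.
move=> s1 As ch itvI Iu0 ctau cth cal cbe tauT hL pI hC pu0.
(* Reading x off the path takes one z-coordinate, which exists because s >= 1. *)
pose i0 : 'I_s := Ordinal s1.
pose U u := (\prod_j (p u).2 0 j) / e1 ((D (inr ord0))%:~R * th u).
pose x u := U u * e1 ((D (inl (lift ord0 i0)))%:~R * th u) * (p u).1 0 i0.
have ce (N : R) : continuous (fun v => e1 (N * th v)).
  move=> u; apply: (@continuous_e1_comp R (fun v => N * th v) u).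
  by apply: cvgM; [exact: cvg_cst|exact: cth].
have ceI (N : R) : {within I, continuous (fun v => e1 (N * th v))}.
  exact: continuous_subspaceT.
have red u : I u -> reduced_eq s a (tau u) (div_class a D) (th u) (x u) (U u) /\
    p u = crit_pt a D (th u) (x u) (U u).
  move=> Iu; have /(Crit_gamma_param (tau u) D (th u) (p u) As)[x' [U' [red pE]]] := hC _ Iu.
  have [UE xE] := crit_ptK red; rewrite -pE in UE xE.
  by rewrite /x (_ : U u = U') // -xE.
have UI : {within I, continuous U}.
  apply: within_continuous_div; last by move=> u _; exact: e1_neq0.
    move/subspace_continuousP : pI => pI; apply/subspace_continuousP => u Iu.
    apply: cvg_prod => j.
    apply: (@cvg_comp _ _ _ (fun v => (p v).2) (fun M : 'rV__ => M 0 j)).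
      by apply: (@cvg_comp _ _ _ p (@snd _ _)); [exact: pI|exact: cvg_snd].
    exact: coord_continuous.
  exact: ceI.
have xI : {within I, continuous x}.
  move/subspace_continuousP : pI => pI; apply/subspace_continuousP => u Iu.
  move/subspace_continuousP : UI => UI.
  apply: cvgM.
    apply: cvgM; first exact: UI.
    have /subspace_continuousP := ceI (D (inl (lift ord0 i0)))%:~R; exact.
  apply: (@cvg_comp _ _ _ (fun v => (p v).1) (fun M : 'rV__ => M 0 i0)).
    by apply: (@cvg_comp _ _ _ p (@fst _ _)); [exact: pI|exact: cvg_fst].
  exact: coord_continuous.
have red0 := reduced_eq_label ch (tauT _ Iu0) (hL _ Iu0).
have [U0E x0E] := crit_ptK red0.
have Uu0 : U u0 = std_lam r (al u0) * V (std_c s a (tau u0) (al u0) (be u0)).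
  by rewrite [RHS]U0E /U pu0.
have xu0 : x u0 = std_c s a (tau u0) (al u0) (be u0) * Y (std_c s a (tau u0) (al u0) (be u0)).
  by rewrite [RHS](x0E i0) /x Uu0 pu0.
have clam : {within I, continuous (fun v => std_lam r (al v))}.
  by apply: continuous_subspaceT => u; apply: continuous_std_lam; exact: cal.
have cc : {within I, continuous (fun v => std_c s a (tau v) (al v) (be v))}.
  by apply: continuous_subspaceT => u; apply: continuous_std_c; [exact: ctau|exact: cal|exact: cbe].
move=> u Iu; have [_ ->] := red _ Iu.
have [-> ->] := chart_rigid ch itvI Iu0 tauT xI UI clam cc (fun v Iv => (red v Iv).1) hL Uu0 xu0 Iu.
by [].
Qed.

(** As t tends to -oo, c tends to 0 and [Y], [V] tend to 1, so only leading terms remain. In z_i = x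
    / U the angle of [std_lam] cancels the last summand of the angle of [std_c]. *)
Lemma std_pt_lim (R : realType) (s r : nat) (a : 'I_r -> nat) (D : DivT s r)
    (T c0 : R) (Y V : Cplx R -> Cplx R) (al be : R) :
  chart s a T c0 Y V ->
  (forall j, (fun u => (std_pt a D Y V u 0 al be).2 0 j / real_complex R 1) u
     @[u --> -oo] --> e1 (al / r.+1%:R)) /\
  (forall i, (fun u => (std_pt a D Y V u 0 al be).1 0 i /
       real_complex R (expR (u / s.+1%:R))) u
     @[u --> -oo] -->
     e1 (al * (\sum_j a j)%:R / (s.+1%:R * r.+1%:R) + be / s.+1%:R)).
Proof.
move=> ch; have FF : Filter (ninfty_nbhs R) by exact: _.
have [Y1 V1] := chart0 ch.
have [|cY cV] := chart_cvg ch (c := 0); first by rewrite cabs0 (chart_gt0 ch).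
have c_0 := @cvg_std_c R s r a al be.
have cst1 (x : Cplx R) : (fun _ : R => x) v @[v --> -oo] --> x by exact: cvg_cst.
have YC : (fun u => Y (std_c s a u al be)) u @[u --> -oo] --> (1 : Cplx R).
  by rewrite -Y1; exact: (cvg_comp _ _ c_0 cY).
have VC : (fun u => V (std_c s a u al be)) u @[u --> -oo] --> (1 : Cplx R).
  by rewrite -V1; exact: (cvg_comp _ _ c_0 cV).
have VC' : (fun u => (V (std_c s a u al be))^-1) u @[u --> -oo] --> (1 : Cplx R)^-1.
  by apply: cvgV; [exact: oner_neq0|exact: VC].
have xC : (fun u => std_c s a u al be * Y (std_c s a u al be)) u @[u --> -oo] -->
    (0 : Cplx R) * 1 by exact: (cvgM c_0 YC).
split=> i.
- have -> : (fun u => (std_pt a D Y V u 0 al be).2 0 i / real_complex R 1) =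
    fun u => (1 - (a i)%:R * (std_c s a u al be * Y (std_c s a u al be))) *
      (V (std_c s a u al be))^-1 * e1 (al / r.+1%:R).
    apply/funext => u; rewrite mxE mulr0 e1_0 rmorph1 !divr1 invfM /std_lam e1N invrK.
    by rewrite -[RHS]mulrA; congr (_ * _); exact: mulrC.
  have lim1 : (1 - (a i)%:R * (0 * 1)) * 1^-1 * e1 (al / r.+1%:R) = e1 (al / r.+1%:R).
    by rewrite mul0r mulr0 subr0 invr1 !mul1r.
  rewrite -[X in _ --> X]lim1.
  exact: (cvgM (cvgM (cvgB (cst1 1) (cvgM (cst1 (a i)%:R) xC)) VC') (cst1 _)).
- have -> : (fun u => (std_pt a D Y V u 0 al be).1 0 i / real_complex R (expR (u / s.+1%:R))) =
    fun u => e1 (al * (\sum_j a j)%:R / (s.+1%:R * r.+1%:R) + be / s.+1%:R) *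
      Y (std_c s a u al be) * (V (std_c s a u al be))^-1.
    apply/funext => u; rewrite mxE mulr0 e1_0 divr1 invfM {1}/std_c e1D e1N /std_lam e1N invrK.
    have E0 := e1_neq0 (al / r.+1%:R).
    have rho0 : real_complex R (expR (u / s.+1%:R)) != 0 :> Cplx R.
      by rewrite -cabs_eq0 cabs_real normr_eq0 gt_eqF// expR_gt0.
    move: rho0 E0.
    move: (real_complex R _ : Cplx R) (e1 (al / _)) (e1 (_ + _)) (V _)^-1 (Y _).
    move=> rho E G V' Y' rho0 E0.
    by field; rewrite rho0 E0.
  set G := e1 _; have lim1 : G * 1 * 1^-1 = G by rewrite invr1 !mulr1.
  rewrite -[X in _ --> X]lim1.
  exact: (cvgM (cvgM (cst1 G) YC) VC').
Qed.

Lemma Crit_std_pt (R : realType) (s r : nat) (a : 'I_r -> nat) (D : DivT s r)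
    (T c0 : R) (Y V : Cplx R -> Cplx R) (t : R) (z : coords R s r) :
  (\sum_j a j <= s)%N -> chart s a T c0 Y V -> t < T -> Crit (LG a t) z ->
  exists (k : 'I_s.+1) (l : 'I_r.+1), z = std_pt a D Y V t 0 l%:R k%:R.
Proof.
move=> As ch tT; rewrite (LG_gamma a t D) => /(Crit_gamma_param t D 0 z As)[x [U [red zE]]].
have [lam [c [L UE xE]]] := chart_label ch tT red.
have [k [l [lamE cE]]] := label_std_exists As L.
by exists k, l; rewrite zE UE xE lamE cE.
Qed.

Lemma continuous_idR (R : realType) : continuous (fun u : R => u).
Proof. by move=> u; exact: cvg_id. Qed.

Lemma continuous_cstR (R : realType) (x : R) : continuous (fun _ : R => x).
Proof. by move=> u; exact: cvg_cst. Qed.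

(** The point p t is standard for some (k', l'). Rigidity on ]-oo, t] makes the whole branch
    standard, so its limiting angles are those of (k', l') as well as those prescribed by (k, l). *)
Lemma branch_std_pt (R : realType) (s r : nat) (a : 'I_r -> nat) (D : DivT s r)
    (T c0 : R) (Y V : Cplx R -> Cplx R) (t : R) (k : 'I_s.+1) (l : 'I_r.+1)
    (p : R -> coords R s r) : (1 <= s)%N -> (1 <= r)%N ->
  (\sum_j a j <= s)%N -> chart s a T c0 Y V -> t < T ->
  is_branch a t k l p -> p t = std_pt a D Y V t 0 l%:R k%:R.
Proof.
move=> s1 r1 As ch tT [pI pC pz pw].
have [k' [l' pt]] := Crit_std_pt D As ch tT (pC t (lexx t)).
have FF : Filter (ninfty_nbhs R) by exact: _.
have pE u : u <= t -> p u = std_pt a D Y V u 0 l'%:R k'%:R.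
  move=> ut; apply: (@path_rigid R s r a D T c0 Y V [set` `]-oo, t]] (fun u => u)
    (fun=> 0) (fun=> l'%:R) (fun=> k'%:R) p t s1 As ch (@interval_is_interval _ _)).
  - by rewrite /= in_itv /=.
  - exact: continuous_idR.
  - exact: continuous_cstR.
  - exact: continuous_cstR.
  - exact: continuous_cstR.
  - by move=> v; rewrite /= in_itv /= => vt; apply: le_lt_trans tT.
  - by move=> v _; exact: label_std0.
  - exact: pI.
  - by move=> v; rewrite /= in_itv /= => vt; rewrite -LG_gamma; exact: pC.
  - exact: pt.
  - by rewrite /= in_itv.
have near_t (x y : R -> Cplx R) al : (forall u, u <= t -> x u = y u) ->
    Arg_cvg_ninfty x al -> Arg_cvg_ninfty y al.
  move=> xy hx U /hx hU; have : \forall u \near -oo, u <= t.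
    by exists t; split; [exact: num_real|move=> u /ltW].
  by apply: filterS2 hU => u hU ut; rewrite -xy.
have [limw limz] := std_pt_lim D l'%:R k'%:R ch.
have eqw : e1 (l%:R / r.+1%:R : R) = e1 (l'%:R / r.+1%:R).
  apply: (Arg_cvg_unique (rho := fun=> 1) _ (limw (Ordinal r1))) => //.
  by apply: near_t (pw (Ordinal r1)) => u ut; rewrite pE.
have eqz : e1 (l%:R * (\sum_j a j)%:R / (s.+1%:R * r.+1%:R) + k%:R / s.+1%:R : R) =
    e1 (l'%:R * (\sum_j a j)%:R / (s.+1%:R * r.+1%:R) + k'%:R / s.+1%:R).
  apply: (Arg_cvg_unique (rho := fun u => expR (u / s.+1%:R)) _ (limz (Ordinal s1))).
    by move=> u; exact: expR_gt0.
  by apply: near_t (pz (Ordinal s1)) => u ut; rewrite pE.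
(* [std_lam] and [std_c] depend on l and k only through the two exponentials just compared. *)
rewrite pt /std_pt; have -> : std_lam r (l'%:R : R) = std_lam r l%:R.
  by rewrite /std_lam !e1N eqw.
have -> // : std_c s a t l'%:R k'%:R = std_c s a t l%:R k%:R.
by rewrite /std_c !(e1D _ (- _)) !e1N eqw eqz.
Qed.

Lemma branch_exists (R : realType) (s r : nat) (a : 'I_r -> nat)
    (T c0 : R) (Y V : Cplx R -> Cplx R) (t : R) (z : coords R s r) :
  (\sum_j a j <= s)%N -> chart s a T c0 Y V -> t < T -> Crit (LG a t) z ->
  exists (k : 'I_s.+1) (l : 'I_r.+1) (p : R -> coords R s r),
    is_branch a t k l p /\ p t = z.
Proof.
move=> As ch tT zC; pose D : DivT s r := 0.
have [k [l zE]] := Crit_std_pt D As ch tT zC.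
exists k, l, (fun u => std_pt a D Y V u 0 l%:R k%:R); split; last exact: esym zE.
have [limw limz] := std_pt_lim D l%:R k%:R ch.
have L (u : R) := label_std0 u (div_class a D) k l As.
split.
- apply: continuous_in_subspaceT => u; rewrite inE /= in_itv /= => ut.
  have uT := le_lt_trans ut tT.
  apply: (@continuous_std_pt R s r a D T c0 Y V (fun v => v) (fun=> 0)
    (fun=> l%:R) (fun=> k%:R) u ch (chart_small ch uT (L u))).
  + exact: continuous_idR.
  + exact: continuous_cstR.
  + exact: continuous_cstR.
  + exact: continuous_cstR.
- move=> u ut; have uT := le_lt_trans ut tT.
  rewrite (LG_gamma a u D); apply/(Crit_gamma_param u D 0 _ As).
  exists (std_c s a u l%:R k%:R * Y (std_c s a u l%:R k%:R)),
    (std_lam r l%:R * V (std_c s a u l%:R k%:R)).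
  by split; [exact: (reduced_eq_label ch uT (L u))|].
- move=> i; apply: (Arg_cvg_of_cvg (rho := fun u => expR (u / s.+1%:R)) _ (limz i)).
  by move=> u; exact: expR_gt0.
- by move=> j; exact: (Arg_cvg_of_cvg (rho := fun=> 1) _ (limw j)).
Qed.

(** [branch_exists] keeps [xget] away from its default value, and [branch_std_pt] locates z
    whichever branch was chosen. *)
Lemma exc_map_std_pt (R : realType) (s r : nat) (a : 'I_r -> nat) (D : DivT s r)
    (T c0 : R) (Y V : Cplx R -> Cplx R) (t : R) (z : coords R s r) :
  (1 <= s)%N -> (1 <= r)%N -> (\sum_j a j <= s)%N -> chart s a T c0 Y V ->
  t < T -> Crit (LG a t) z ->
  z = std_pt a D Y V t 0 (exc_map a t z).2%:~R (exc_map a t z).1%:~R.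
Proof.
move=> s1 r1 As ch tT zC.
have [k0 [l0 [p0 [br0 pz0]]]] := branch_exists As ch tT zC.
have [k [l [p [br pz ->]]]] : exists (k : 'I_s.+1) (l : 'I_r.+1) (p : R -> coords R s r),
    [/\ is_branch a t k l p, p t = z & exc_map a t z = piH *~ k%:Z + xi *~ l%:Z].
  apply: (@xgetPex _ (0 : Pic) [set L : Pic |
    exists (k : 'I_s.+1) (l : 'I_r.+1) (p : R -> coords R s r),
      [/\ is_branch a t k l p, p t = z & L = piH *~ k%:Z + xi *~ l%:Z]]).
  by exists (piH *~ k0%:Z + xi *~ l0%:Z), k0, l0, p0.
have PicE (x y : nat) : piH *~ x%:Z + xi *~ y%:Z = (x%:Z, y%:Z).
  have H1 (m : nat) : (piH *+ m : Pic) = (m%:Z, 0).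
    elim: m => // m IH; rewrite mulrS IH; apply/eqP.
    by rewrite xpair_eqE /= -intS ?addr0 !eqxx.
  have H2 (m : nat) : (xi *+ m : Pic) = (0, m%:Z).
    elim: m => // m IH; rewrite mulrS IH; apply/eqP.
    by rewrite xpair_eqE /= -intS ?addr0 !eqxx.
  by rewrite -!pmulrn H1 H2; apply/eqP; rewrite xpair_eqE /= ?addr0 ?add0r !eqxx.
by rewrite PicE /= -pz; exact: (branch_std_pt D s1 r1 As ch tT br).
Qed.

Theorem theoremB (R : realType) (s r : nat) (a : 'I_r -> nat) :
  (1 <= s)%N -> (1 <= r)%N ->
  (forall i j : 'I_r, (i <= j)%N -> (a i <= a j)%N) ->
  (\sum_i a i <= s)%N ->
  exists T : R, forall t : R, t < T ->
  forall z1 z2 : coords R s r, Crit (LG a t) z1 -> Crit (LG a t) z2 ->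
  forall D : DivT s r,
    HomD R a D (exc_map a t z1) (exc_map a t z2) <> [set 0] ->
    monodromy a t D z1 = z2.
Proof.
move=> s1 r1 _ As; have [T [c0 [Y [V ch]]]] := @chart_exists R s r a As.
exists T => t tT z1 z2 zC1 zC2 D.
(* A piece other than [[set 0]] forces the class of [D] to be E(z2) - E(z1). *)
rewrite /HomD; case: ifP => // /andP[_ /eqP dE] _.
have z1E := exc_map_std_pt D s1 r1 As ch tT zC1.
have z2E := exc_map_std_pt D s1 r1 As ch tT zC2.
move: dE z1E z2E; case: (exc_map a t z1) (exc_map a t z2) => k1 l1 [k2 l2] dE z1E z2E.
(* Linear motion from (k1, l1) to (k1, l1) + [D], at the speed that [label_std] prescribes. *)
pose al th : R := l1%:~R + (div_class a D).2%:~R * th.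
pose be th : R := k1%:~R + (div_class a D).1%:~R * th.
pose p th := std_pt a D Y V t th (al th) (be th).
have L th : label s a t (div_class a D) th (std_lam r (al th)) (std_c s a t (al th) (be th)).
  exact: label_std.
have aff (x y : R) : continuous (fun th : R => x + y * th).
  move=> u; apply: cvgD; first exact: cvg_cst.
  by apply: cvgM; [exact: cvg_cst|exact: cvg_id].
have p0 : p 0 = z1 by rewrite /p /al /be !mulr0 !addr0 z1E.
(* By [dE] the parameters end at (k2, l2), and the coefficients of the loop are back at their
   initial values. *)
have p1 : p 1 = z2.
  rewrite /p /al /be !mulr1 -!rmorphD /= dE /=.
  rewrite addrC subrK [k1 + _]addrC subrK /std_pt crit_pt_period.
  by rewrite -/(std_pt _ _ _ _ _ _ _ _) -z2E.
(* [p] shows that an end point exists; [path_rigid] then makes every path of critical points from z1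
   coincide with [p], so the end point is unique. *)
rewrite /monodromy; apply: xget_unique.
  exists p; split; [|move=> th _|exact: p0|exact: p1].
  - apply: continuous_in_subspaceT => u _.
    apply: (@continuous_std_pt R s r a D T c0 Y V (fun=> t) (fun v => v)
      al be u ch (chart_small ch tT (L u))).
    + exact: continuous_cstR.
    + exact: continuous_idR.
    + exact: aff.
    + exact: aff.
  - apply/(Crit_gamma_param t D th _ As).
    exists (std_c s a t (al th) (be th) * Y (std_c s a t (al th) (be th))),
      (std_lam r (al th) * V (std_c s a t (al th) (be th))).
    by split; [exact: (reduced_eq_label ch tT (L th))|].
move=> y [q [qI qC q0 <-]]; rewrite -p1.
apply: (@path_rigid R s r a D T c0 Y V [set` `[0, 1]] (fun=> t) (fun u => u) al be
  q 0 s1 As ch (@interval_is_interval _ _)).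
- by rewrite /= in_itv /= lexx ler01.
- exact: continuous_cstR.
- exact: continuous_idR.
- exact: aff.
- exact: aff.
- by [].
- by move=> th _; exact: L.
- exact: qI.
- by move=> th hth; exact: qC.
- by rewrite q0 -p0.
- by rewrite /= in_itv /= lexx ler01.
Qed.
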